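(* For any positional scoring rule $r$, there is a polynomial-time algorithm that, given a finite set $\mathcal{C}$ of alternatives, an alternative $c\in\mathcal{C}$ and a profile $P_{poset}$ of partial orders on $\mathcal{C}$, checks whether or not $c$ is a necessary winner for $P_{poset}$ with respect to $r$.
   Context: Let $\mathcal{C}$ be a finite set of $m$ alternatives; $m$ is part of the input and not bounded, and votes are unweighted. A (complete) profile is a finite list $P=(V_1,\dots,V_n)$ of linear orders on $\mathcal{C}$. A voting rule $r$ maps each profile to a nonempty subset of $\mathcal{C}$ (the winners). A partial order is a reflexive, transitive, antisymmetric relation; a linear order $V$ extends a partial order $O$ if $O\subseteq V$. A profile $P=(V_1,\dots,V_n)$ of linear orders extends a profile $P_{poset}=(O_1,\dots,O_n)$ of partial orders if each $V_i$ extends $O_i$. An alternative $c$ is a necessary winner for $P_{poset}$ with respect to $r$ if every extension $P$ of $P_{poset}$ satisfies $r(P)=\{c\}$. A positional scoring rule consists of a sequence of scoring vectors $\{\vec{s}_1,\vec{s}_2,\ldots\}$, where for each $m$, $\vec{s}_m=(\vec{s}_m(1),\ldots,\vec{s}_m(m))$ is a vector of $m$ non-negative integers with $\vec{s}_m(1)\ge\cdots\ge\vec{s}_m(m)$; it is assumed that $\vec{s}_m$ can be computed in time polynomial in $m$. For a profile over $m$ alternatives, each vote gives $\vec{s}_m(j)$ points to the alternative it ranks in position $j$ from the top, and the winners are the alternatives with maximum total score. *)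

(* Defs.v *)
From Corelib Require Import BinNums.
From mathcomp Require Import all_boot all_algebra.
Set Implicit Arguments.
Unset Strict Implicit.
Unset Printing Implicit Defensive.

(* Deterministic multi-tape Turing machines with two-way infinite tapes. *)

Section Tape.
Variable A : Type.
Variable blank : A.

(* The cells to the left of the head are listed from the head outwards; the
   cells beyond both lists are blank. *)
Record tape := Tape { tleft : seq A ; thead : A ; tright : seq A }.

Inductive move := MoveLeft | Stay | MoveRight.

Definition write (a : A) (t : tape) : tape := Tape (tleft t) a (tright t).

Definition shift (d : move) (t : tape) : tape :=
  match d with
  | MoveLeft =>
      Tape (behead (tleft t)) (head blank (tleft t)) (thead t :: tright t)
  | Stay => t
  | MoveRight =>
      Tape (thead t :: tleft t) (head blank (tright t)) (behead (tright t))
  end.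

Definition tape_of_seq (s : seq A) : tape :=
  Tape [::] (head blank s) (behead s).

End Tape.

(* [None] is the blank; besides the bits used for input and output, a machine
   may use finitely many work symbols of its own. *)
Definition cell (W : Type) := option (bool + W).

Record machine := Machine {
  work : finType;
  state : finType;
  ntapes : nat;   (* the machine has [ntapes.+1] tapes *)
  start : state;
  halting : pred state;
  trans : state -> {ffun 'I_ntapes.+1 -> cell work} ->
          state * {ffun 'I_ntapes.+1 -> cell work * move}
}.

Section Run.
Variable M : machine.

Record config := Config {
  cstate : state M;
  ctapes : {ffun 'I_(ntapes M).+1 -> tape (cell (work M))}
}.

Definition bit_cell (b : bool) : cell (work M) := Some (inl b).

Definition init (w : seq bool) : config :=
  Config (start M)
    [ffun i => tape_of_seq None (if i == ord0 then map bit_cell w else [::])].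

Definition step (c : config) : config :=
  if halting (cstate c) then c else
  let: (q, act) := trans (cstate c) [ffun i => thead (ctapes c i)] in
  Config q
    [ffun i => shift None (act i).2 (write (act i).1 (ctapes c i))].

Fixpoint read_bits (s : seq (cell (work M))) : seq bool :=
  if s is Some (inl b) :: s' then b :: read_bits s' else [::].

(* The output is the word on the last tape that starts under the head and
   extends to the right up to the first cell that does not hold a bit. *)
Definition output (c : config) : seq bool :=
  let t := ctapes c ord_max in read_bits (thead t :: tright t).

(* Halting configurations are fixpoints of [step], so this says that [M] halts
   on [w] after at most [T] steps with output [v]. *)
Definition halts_within (T : nat) (w v : seq bool) : Prop :=
  let c := iter T step (init w) in halting (cstate c) /\ output c = v.

End Run.

Definition polytime_computable (X Y : Type) (encX : X -> seq bool)
    (encY : Y -> seq bool) (f : X -> Y) : Prop :=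
  exists (M : machine) (p : {poly nat}),
    forall x : X, halts_within M p.[size (encX x)]%R (encX x) (encY (f x)).

Definition polytime_decidable (X : Type) (encX : X -> seq bool)
    (L : X -> Prop) : Prop :=
  exists2 f : X -> bool, (forall x, f x <-> L x) &
    polytime_computable encX (fun b => [:: b]) f.

(* Self-delimiting encoding of a list of bit strings: each bit is preceded by
   [true] and each string is followed by [false]. *)
Definition enc_word (w : seq bool) : seq bool :=
  rcons (flatten [seq [:: true; b] | b <- w]) false.

Definition enc_words (ws : seq (seq bool)) : seq bool :=
  flatten (map enc_word ws).

(* Binary notation, least significant bit first, without leading zeros. *)
Fixpoint bits_of_pos (p : positive) : seq bool :=
  match p with
  | xH => [:: true]
  | xO q => false :: bits_of_pos q
  | xI q => true :: bits_of_pos q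
  end.

Definition bits_of_nat (n : nat) : seq bool :=
  if bin_of_nat n is Npos p then bits_of_pos p else [::].

Definition unary (n : nat) : seq bool := nseq n true.

(* [O x y] reads: [x] is ranked at least as high as [y]. *)
Record partial_order (C : finType) := PartialOrder {
  po_rel :> rel C;
  po_refl : reflexive po_rel;
  po_anti : antisymmetric po_rel;
  po_trans : transitive po_rel
}.

Record linear_order (C : finType) := LinearOrder {
  lo_po :> partial_order C;
  lo_total : total lo_po
}.

Definition profile (C : finType) (n : nat) := n.-tuple (linear_order C).
Definition poset_profile (C : finType) (n : nat) := n.-tuple (partial_order C).

Definition extends (C : finType) (n : nat)
    (P : profile C n) (O : poset_profile C n) : Prop :=
  forall i : 'I_n, subrel (tnth O i) (tnth P i).

Record voting_rule := VotingRule {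
  winners :> forall (C : finType) (n : nat), profile C n -> {set C};
  winners_neq0 : forall (C : finType) (n : nat) (P : profile C n),
    0 < #|C| -> winners P != set0
}.

Definition necessary_winner (r : voting_rule) (C : finType) (n : nat)
    (O : poset_profile C n) (c : C) : Prop :=
  forall P : profile C n, extends P O -> r C n P = [set c].

Definition scoring_vectors := forall m : nat, m.-tuple nat.

Definition position (C : finType) (V : linear_order C) (x : C) : nat :=
  #|[set y | V y x]|.

(* Positions start at 1 whereas [nth] counts from 0. *)
Definition score (s : scoring_vectors) (C : finType) (n : nat)
    (P : profile C n) (x : C) : nat :=
  \sum_(V <- P) nth 0 (s #|C|) (position V x).-1.

Definition scoring_winners (s : scoring_vectors) (C : finType) (n : nat)
    (P : profile C n) : {set C} :=
  [set x | [forall y, score s P y <= score s P x]].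

Lemma scoring_winners_neq0 (s : scoring_vectors) (C : finType) (n : nat)
    (P : profile C n) : 0 < #|C| -> scoring_winners s P != set0.
Proof.
case/card_gt0P=> x0 _; apply/set0Pn.
case: (arg_maxnP (P := xpredT) (score s P) (i0 := x0)) => // x _ max_x.
by exists x; rewrite inE; apply/forallP => y; apply: max_x.
Qed.

Definition scoring_rule (s : scoring_vectors) : voting_rule :=
  VotingRule (@scoring_winners_neq0 s).

(* Only vectors of length at least 1 are considered, hence the successors. The
   length is given in unary, so that the time is polynomial in the length
   itself, while the entries of the vector are output in binary. *)
Definition polytime_scoring_vectors (s : scoring_vectors) : Prop :=
  polytime_computable (fun k => unary k.+1)
    (fun v : seq nat => enc_words (map bits_of_nat v)) (fun k => s k.+1).

Definition positional_scoring_rule (s : scoring_vectors) : Prop :=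
  (forall m, sorted geq (s m)) /\ polytime_scoring_vectors s.

Record nw_instance := NWInstance {
  alternatives : finType;
  candidate : alternatives;
  nvoters : nat;
  partial_votes : poset_profile alternatives nvoters
}.

Definition enc_partial_order (C : finType) (O : partial_order C) : seq bool :=
  [seq O x y | x <- enum C, y <- enum C].

(* The alternatives are numbered by their position in [enum]; the candidate is
   given by its characteristic vector and each partial order by its incidence
   matrix, row by row. *)
Definition enc_instance (I : nw_instance) : seq bool :=
  enc_words
    [:: unary #|alternatives I|,
        [seq x == candidate I | x <- enum (alternatives I)] &
        [seq enc_partial_order Q | Q <- partial_votes I]].

(* Main.v *)
Require Import Defs.
From mathcomp Require Import all_boot all_algebra.
From mathcomp Require Import zify.
Import Defs.
Set Implicit Arguments.
Unset Strict Implicit.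
Unset Printing Implicit Defensive.

(* Votes can be completed independently, so [c] is a necessary winner iff for
   every [d] other than [c] the sum over the votes of the largest possible
   value of (points of [d]) - (points of [c]) is negative. If a vote does not put
   [c] above [d], this value is reached with [d] as high and [c] as low as
   possible; if it does, with only the [b] alternatives that must lie between
   them (both included) placed in one block, which slides over at most [m]
   positions. Trying all of them takes polynomially many operations on numbers in
   binary.

   For the Turing machines, the functions between encoded types that are computed
   in polynomial time by programs on stack registers are closed under
   composition, pairing, case distinction and, as long as the accumulator stays
   polynomially small, iteration over a list; each stack is one tape. Run on the
   number of alternatives in unary, the machine for the scoring vectors provides
   the remaining input. *)

(** * Polynomial bounds *)

(** Scoring vectors are non-increasing, so within a vote raising [d] or lowering [c] never decreases
    the difference of their points. If [c] need not be above [d], nothing lies both below [c] and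
    above [d], and a single extension attains both extremes. Otherwise the two aims conflict: the
    alternatives forced between them keep [c] and [d] at least [b - 1] places apart, and raising [d]
    eventually forces [c] up as well. The decrements of the vector being arbitrary, no place of the
    block is best in advance, which is why all of them are compared. Differences are never computed:
    a gain is a pair of natural numbers, and pairs are compared by adding crosswise. On the side of
    the machines the obstacle is that the scoring vectors are known only through some machine with
    its own alphabet and tapes, which cannot be rewritten as a program on registers. Programs are
    therefore compiled over an arbitrary alphabet and an arbitrary placement of the registers among
    the tapes, so that they can be chained with that machine. *)

Definition poly_bounded (f : nat -> nat) := exists k, forall n, f n <= n.+2 ^ k.

Lemma leq_expl k m n : m <= n -> m ^ k <= n ^ k.
Proof. by case: k => // k; rewrite leq_exp2r. Qed.

Lemma poly_bounded_le (f g : nat -> nat) :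
  (forall n, f n <= g n) -> poly_bounded g -> poly_bounded f.
Proof. by move=> le_fg [k le_g]; exists k => n; apply: leq_trans (le_g n). Qed.

Lemma poly_bounded_id : poly_bounded id.
Proof. by exists 1 => n; rewrite expn1 /= ltnW // ltnW. Qed.

Lemma poly_bounded_const c : poly_bounded (fun=> c).
Proof.
exists c => n; apply: leq_trans (ltnW (ltn_expl c (isT : 1 < 2))) _.
exact: leq_expl.
Qed.

Lemma poly_boundedX k : poly_bounded (fun n => n.+2 ^ k).
Proof. by exists k. Qed.

(** The base [n.+2] is at least 2, so the factor 2 is absorbed by one more power; this is why the
    bounds need no coefficients. *)
Lemma poly_boundedD (f g : nat -> nat) :
  poly_bounded f -> poly_bounded g -> poly_bounded (fun n => f n + g n).
Proof.
move=> [k le_f] [l le_g]; exists (k + l).+1 => n.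
apply: leq_trans (leq_add (le_f n) (le_g n)) _.
have le_exp i j : n.+2 ^ i <= n.+2 ^ (i + j) by rewrite leq_exp2l ?leq_addr.
rewrite expnS (leq_trans (leq_add (le_exp k l) (le_exp l k))) //.
by rewrite [l + k]addnC addnn -mul2n leq_mul2r orbT.
Qed.

Lemma poly_boundedM (f g : nat -> nat) :
  poly_bounded f -> poly_bounded g -> poly_bounded (fun n => f n * g n).
Proof.
move=> [k le_f] [l le_g]; exists (k + l) => n.
by rewrite expnD leq_mul.
Qed.

Lemma poly_bounded_comp (f g : nat -> nat) :
  poly_bounded f -> poly_bounded g -> poly_bounded (fun n => f (g n)).
Proof.
(* Two extra factors [n.+2] multiply [n.+2 ^ l] by at least 4, which covers the 2 added in
   [(g n).+2]. *)
move=> [k le_f] [l le_g]; exists (l.+2 * k) => n.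
apply: leq_trans (le_f _) _; rewrite expnM.
apply: leq_expl.
have := le_g n; have: 0 < n.+2 ^ l by rewrite expn_gt0.
by rewrite 2!expnS; nia.
Qed.

Lemma poly_boundedS (f : nat -> nat) :
  poly_bounded f -> poly_bounded (fun n => (f n).+1).
Proof.
by move=> pb_f; apply: poly_bounded_le (poly_boundedD (poly_bounded_const 1) pb_f).
Qed.

Ltac poly_bound :=
  repeat first [ assumption | exact: poly_bounded_id
    | exact: poly_bounded_const | exact: poly_boundedX
    | apply: poly_boundedS | apply: poly_boundedD | apply: poly_boundedM
    | apply: (@poly_bounded_comp (fun n => n.+2 ^ _)) ].

Lemma poly_boundedP (f : nat -> nat) :
  poly_bounded f ->
  exists p : {poly nat}, forall n, f n <= (p.[n])%R.
Proof.
case=> k le_f; exists (('X + 2%:R%:P) ^+ k)%R => n.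
rewrite horner_exp hornerD hornerX hornerC.
suff ->: ((n + 2%:R) ^+ k)%R = n.+2 ^ k by [].
rewrite [(n + 2%:R)%R](_ : _ = n.+2); last exact: addn2.
by elim: k {le_f} => // k IH; rewrite GRing.exprS IH expnS.
Qed.

(** * Structured Turing machine programs *)

Section Fragments.
Variables (I W : finType).
Notation A := (cell W).
Notation heads := {ffun I -> A}.
Notation action := {ffun I -> A * move}.
Notation tapes := {ffun I -> tape A}.

(* [None] as next state means that control leaves the fragment. *)
Record fragment := Fragment {
  fstate : finType;
  fstart : fstate;
  fdelta : fstate -> heads -> option fstate * action
}.

Definition heads_of (T : tapes) : heads := [ffun i => thead (T i)].
Definition act (a : action) (T : tapes) : tapes :=
  [ffun i => shift None (a i).2 (write (a i).1 (T i))].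

(* [reaches F q T t T']: from state [q] on [T], [F] exits within [t] steps
   leaving [T']. *)
Inductive reaches (F : fragment) : fstate F -> tapes -> nat -> tapes -> Prop :=
| reaches_exit q T a t :
    fdelta q (heads_of T) = (None, a) -> 0 < t -> reaches q T t (act a T)
| reaches_step q T q' a t T' :
    fdelta q (heads_of T) = (Some q', a) -> reaches q' (act a T) t T' ->
    reaches q T t.+1 T'.

Definition runs (F : fragment) T t T' := reaches (fstart F) T t T'.

Lemma reaches_le F (q : fstate F) T t t' T' :
  t <= t' -> reaches q T t T' -> reaches q T t' T'.
Proof.
move=> le_t run; elim: run t' le_t => {q T t T'}
  [q T a t del t_gt0 | q T q' a t T' del _ IH] t' le_t.
  exact: reaches_exit del (leq_trans t_gt0 le_t).
by case: t' le_t => // t' le_t; apply: reaches_step del (IH _ le_t).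
Qed.

Lemma runs_le F T t t' T' : t <= t' -> runs F T t T' -> runs F T t' T'.
Proof. exact: reaches_le. Qed.

Definition nop_action (h : heads) : action := [ffun i => (h i, Stay)].

Lemma act_nop T : act (nop_action (heads_of T)) T = T.
Proof. by apply/ffunP => i; rewrite !ffunE; case: (T i). Qed.

Definition atom (f : heads -> action) : fragment :=
  @Fragment unit tt (fun _ h => (None, f h)).

Lemma runs_atom f T : runs (atom f) T 1 (act (f (heads_of T)) T).
Proof. exact: reaches_exit. Qed.

Section Seq.
Variables F G : fragment.

Definition fseq : fragment :=
  @Fragment (fstate F + fstate G)%type (inl (fstart F))
    (fun q h => match q with
     | inl q => let: (o, a) := fdelta q h in
                (Some (if o is Some q' then inl q' else inr (fstart G)), a)
     | inr q => let: (o, a) := fdelta q h in (omap inr o, a)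
     end).

Lemma reaches_fseqr (q : fstate G) T t T' :
  reaches q T t T' -> reaches (inr q : fstate fseq) T t T'.
Proof.
elim=> {q T t T'} [q T a t del t_gt0 | q T q' a t T' del _ IH].
  by apply: reaches_exit => //=; rewrite del.
by apply: reaches_step IH => /=; rewrite del.
Qed.

Lemma runs_fseq T t T1 t' T' :
  runs F T t T1 -> runs G T1 t' T' -> runs fseq T (t + t') T'.
Proof.
rewrite /runs /=; move: (fstart F) => q run1 run2.
elim: run1 run2 => {q T t T1} [q T a t del t_gt0 | q T q' a t T1 del _ IH] run2.
  apply: (@reaches_le _ _ _ t'.+1); first by lia.
  by apply: reaches_step (reaches_fseqr run2); rewrite /= del.
by apply: reaches_step (IH run2); rewrite /= del.
Qed.
End Seq.

Section If.
Variables (p : heads -> bool) (F G : fragment).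

(** State [None] performs the test and leaves the tapes as they are; it costs the one additional
    step in [runs_fif]. *)
Definition fif : fragment :=
  @Fragment (option (fstate F + fstate G)) None
    (fun q h => match q with
     | None => (Some (Some (if p h then inl (fstart F) else inr (fstart G))),
                nop_action h)
     | Some (inl q) =>
         let: (o, a) := fdelta q h in (omap (Some \o inl) o, a)
     | Some (inr q) =>
         let: (o, a) := fdelta q h in (omap (Some \o inr) o, a)
     end).

Lemma reaches_fifl (q : fstate F) T t T' :
  reaches q T t T' -> reaches (Some (inl q) : fstate fif) T t T'.
Proof.
elim=> {q T t T'} [q T a t del t_gt0 | q T q' a t T' del _ IH].
  by apply: reaches_exit => //=; rewrite del.
by apply: reaches_step IH => /=; rewrite del.
Qed.

Lemma reaches_fifr (q : fstate G) T t T' :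
  reaches q T t T' -> reaches (Some (inr q) : fstate fif) T t T'.
Proof.
elim=> {q T t T'} [q T a t del t_gt0 | q T q' a t T' del _ IH].
  by apply: reaches_exit => //=; rewrite del.
by apply: reaches_step IH => /=; rewrite del.
Qed.

Lemma runs_fif T t T' :
  (if p (heads_of T) then runs F T t T' else runs G T t T') ->
  runs fif T t.+1 T'.
Proof.
move=> run; apply: reaches_step => //=; rewrite act_nop.
by case: (p _) run; [apply: reaches_fifl | apply: reaches_fifr].
Qed.
End If.

Section While.
Variables (p : heads -> bool) (F : fragment).

Definition fwhile : fragment :=
  @Fragment (option (fstate F)) None
    (fun q h => match q with
     | None => (if p h then Some (Some (fstart F)) else None, nop_action h)
     | Some q => let: (o, a) := fdelta q h in (Some o, a)
     end).

Lemma runs_fwhile_end T : p (heads_of T) = false -> runs fwhile T 1 T.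
Proof.
by move=> pF; rewrite -{2}[T]act_nop; apply: reaches_exit => //=; rewrite pF.
Qed.

Lemma runs_fwhile_next T t T1 t' T' :
  p (heads_of T) -> runs F T t T1 -> runs fwhile T1 t' T' ->
  runs fwhile T (t + t').+1 T'.
Proof.
move=> pT run1 run2.
apply: (@reaches_step fwhile _ _ (Some (fstart F))); first by rewrite /= pT.
rewrite act_nop; move: run1; rewrite /runs; move: (fstart F) => q run1 {pT}.
elim: run1 run2 => {q T t T1} [q T a t del t_gt0 | q T q' a t T1 del _ IH] run2.
  apply: (@reaches_le _ _ _ t'.+1); first by lia.
  by apply: reaches_step run2; rewrite /= del.
by apply: reaches_step (IH run2); rewrite /= del.
Qed.
End While.

Definition set_tape (T : tapes) i t : tapes := [ffun j => if j == i then t else T j].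

Lemma set_tapeE T i t : set_tape T i t i = t.
Proof. by rewrite ffunE eqxx. Qed.

Lemma set_tapeN T i t j : j != i -> set_tape T i t j = T j.
Proof. by rewrite ffunE => /negPf->. Qed.

Definition on_tape (i : I) (a : A -> A * move) : fragment :=
  atom (fun h => [ffun j => if j == i then a (h i) else (h j, Stay)]).

Lemma runs_on_tape i a T :
  runs (on_tape i a) T 1
    (set_tape T i (shift None (a (thead (T i))).2
                     (write (a (thead (T i))).1 (T i)))).
Proof.
have:= runs_atom
  (fun h : heads => [ffun j => if j == i then a (h i) else (h j, Stay)] : action) T.
congr (runs _ _ _ _); apply/ffunP => j; rewrite !ffunE.
by case: eqP => [->|_]; rewrite ?ffunE //=; case: (T j).
Qed.

End Fragments.

(** * Stacks of bits on tapes *)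

Section Stacks.
Variables (I W : finType).
Implicit Type T : {ffun I -> tape (cell W)}.

(* The top of the stack is under the head. Popping leaves blanks on the left,
   but the cells to the right of the stack are never touched. *)
Definition stack j (s : seq bool) : tape (cell W) :=
  let w := [seq Some (inl b) | b <- s] in
  Tape (nseq j None) (head None w) (behead w).

Definition bit_of (a : cell W) : option bool :=
  if a is Some (inl b) then Some b else None.

Lemma bit_of_stack j s : bit_of (thead (stack j s)) = ohead s.
Proof. by case: s. Qed.

(** On an empty stack the head stands on a blank, which is overwritten in place; only a non-empty
    stack requires a move to the left, over a blank left by an earlier pop or onto a fresh cell. *)
Definition fpush (i : I) (b : bool) : fragment I W :=
  fif (fun h => h i : bool)
    (fseq (on_tape i (fun a => (a, MoveLeft)))
          (on_tape i (fun=> (Some (inl b), Stay))))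
    (on_tape i (fun=> (Some (inl b), Stay))).

Definition fpop (i : I) : fragment I W := on_tape i (fun=> (None, MoveRight)).

Lemma set_tape_set T i t t' : set_tape (set_tape T i t) i t' = set_tape T i t'.
Proof. by apply/ffunP => j; rewrite !ffunE; case: eqP. Qed.

Lemma runs_fpush T i b j s : T i = stack j s ->
  runs (fpush i b) T 3 (set_tape T i (stack (j - (s != [::])) (b :: s))).
Proof.
move=> Ti; apply: runs_fif; rewrite ffunE Ti.
case: s Ti => [|a s] Ti /=.
  apply: (runs_le (isT : 1 <= 2)).
  by have := runs_on_tape i (fun=> (Some (inl b), Stay)) T; rewrite Ti /= subn0.
have run1 := runs_on_tape i (fun a => (a, MoveLeft)) T.
have := runs_fseq run1 (runs_on_tape i (fun=> (Some (inl b), Stay)) _).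
rewrite Ti set_tapeE set_tape_set /= /write /=.
by rewrite subn1 (_ : behead (nseq j None) = nseq j.-1 None) //; case: j {Ti run1}.
Qed.

Lemma runs_fpop T i j s : T i = stack j s ->
  runs (fpop i) T 1 (set_tape T i (stack j.+1 (behead s))).
Proof.
move=> Ti; have := runs_on_tape i (fun=> (None, MoveRight)) T.
by rewrite Ti /=; case: s Ti.
Qed.

End Stacks.

(** * A language of programs on stack registers *)

Definition store := nat -> seq bool.

Definition upd (s : store) r w : store := fun i => if i == r then w else s i.

Inductive cmd :=
| Push of nat & bool
| Pop of nat
| Seq of cmd & cmd
| If of pred (option bool) & nat & cmd & cmd
| While of pred (option bool) & nat & cmd.

(** The costs are those of the compiled fragments. [exec_weaken] relaxes the time bound and also
    replaces the final store by a pointwise equal one, so that functional extensionality is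
    avoided. *)
Inductive exec : cmd -> store -> nat -> store -> Prop :=
| exec_push r b s : exec (Push r b) s 3 (upd s r (b :: s r))
| exec_pop r s : exec (Pop r) s 1 (upd s r (behead (s r)))
| exec_seq c d s t s1 t' s' :
    exec c s t s1 -> exec d s1 t' s' -> exec (Seq c d) s (t + t') s'
| exec_ifT (p : pred (option bool)) r c d s t s' :
    p (ohead (s r)) -> exec c s t s' -> exec (If p r c d) s t.+1 s'
| exec_ifF (p : pred (option bool)) r c d s t s' :
    ~~ p (ohead (s r)) -> exec d s t s' -> exec (If p r c d) s t.+1 s'
| exec_while_end (p : pred (option bool)) r c s :
    ~~ p (ohead (s r)) -> exec (While p r c) s 1 s
| exec_while_next (p : pred (option bool)) r c s t s1 t' s' :
    p (ohead (s r)) -> exec c s t s1 -> exec (While p r c) s1 t' s' ->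
    exec (While p r c) s (t + t').+1 s'
| exec_weaken c s t t' s' s'' :
    t <= t' -> s' =1 s'' -> exec c s t s' -> exec c s t' s''.

Fixpoint registers (c : cmd) : nat :=
  match c with
  | Push r _ | Pop r => r.+1
  | Seq c d => maxn (registers c) (registers d)
  | If _ r c d => maxn r.+1 (maxn (registers c) (registers d))
  | While _ r c => maxn r.+1 (registers c)
  end.

Section Compile.
Variables (I W : finType) (reg : nat -> I).

Fixpoint compile (c : cmd) : fragment I W :=
  match c with
  | Push r b => fpush W (reg r) b
  | Pop r => fpop W (reg r)
  | Seq c d => fseq (compile c) (compile d)
  | If p r c d => fif (fun h => p (bit_of (h (reg r)))) (compile c) (compile d)
  | While p r c => fwhile (fun h => p (bit_of (h (reg r)))) (compile c)
  end.

Variable R : nat.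
Hypothesis reg_inj : {in gtn R &, injective reg}.

Definition stores (T : {ffun I -> tape (cell W)}) (s : store) :=
  forall r, r < R -> exists j, T (reg r) = stack W j (s r).

(** Needed when a program runs beside the tapes of another machine: the head on the output tape must
    still be where that machine's output ended. *)
Definition agree_off (T T' : {ffun I -> tape (cell W)}) :=
  forall i, (forall r, r < R -> i <> reg r) -> T' i = T i.

Lemma stores_head T s r :
  stores T s -> r < R -> bit_of (heads_of T (reg r)) = ohead (s r).
Proof. by move=> Ts /Ts[j Tr]; rewrite ffunE Tr bit_of_stack. Qed.

Lemma stores_upd T s r j w : stores T s -> r < R ->
  stores (set_tape T (reg r) (stack W j w)) (upd s r w) /\
  agree_off T (set_tape T (reg r) (stack W j w)).
Proof.
move=> Ts ltr; split=> [r' ltr' | i Ni]; last first.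
  by rewrite set_tapeN //; apply/eqP/Ni.
rewrite /upd; case: eqP => [-> | neq]; first by rewrite set_tapeE; exists j.
by rewrite set_tapeN; [apply: Ts | apply/eqP=> /reg_inj eqr; apply/neq/eqr].
Qed.

Lemma compileP c s t s' : exec c s t s' -> registers c <= R ->
  forall T, stores T s ->
  exists T', [/\ runs (compile c) T t T', stores T' s' & agree_off T T'].
Proof.
elim=> {c s t s'} /=.
- move=> r b s ltr T Ts; have [j Tr] := Ts r ltr.
  have [? ?] := stores_upd (j - (s r != [::])) (b :: s r) Ts ltr.
  by exists (set_tape T (reg r) (stack W (j - (s r != [::])) (b :: s r)));
    split=> //; apply: runs_fpush.
- move=> r s ltr T Ts; have [j Tr] := Ts r ltr.
  have [? ?] := stores_upd j.+1 (behead (s r)) Ts ltr.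
  by exists (set_tape T (reg r) (stack W j.+1 (behead (s r))));
    split=> //; apply: runs_fpop.
- move=> c d s t s1 t' s' _ IHc _ IHd; rewrite geq_max => /andP[lec led] T Ts.
  have [T1 [run1 Ts1 agr1]] := IHc lec T Ts.
  have [T2 [run2 Ts2 agr2]] := IHd led T1 Ts1.
  exists T2; split=> //; first exact: runs_fseq run1 run2.
  by move=> i Ni; rewrite agr2 ?agr1.
- move=> p r c d s t s' pr _ IH; rewrite !geq_max => /and3P[ltr lec led] T Ts.
  have [T1 [run1 Ts1 agr1]] := IH lec T Ts.
  by exists T1; split=> //; apply: runs_fif; rewrite (stores_head Ts ltr) pr.
- move=> p r c d s t s' pr _ IH; rewrite !geq_max => /and3P[ltr lec led] T Ts.
  have [T1 [run1 Ts1 agr1]] := IH led T Ts.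
  exists T1; split=> //; apply: runs_fif.
  by rewrite (stores_head Ts ltr) (negPf pr).
- move=> p r c s pr; rewrite !geq_max => /andP[ltr lec] T Ts.
  exists T; split=> //; apply: runs_fwhile_end.
  by rewrite (stores_head Ts ltr) (negPf pr).
- move=> p r c s t s1 t' s' pr _ IHc _ IHw lew T Ts.
  have /andP[ltr lec]: (r < R) && (registers c <= R) by rewrite -geq_max.
  have [T1 [run1 Ts1 agr1]] := IHc lec T Ts.
  have [T2 [run2 Ts2 agr2]] := IHw lew T1 Ts1.
  exists T2; split=> //; last by move=> i Ni; rewrite agr2 ?agr1.
  by apply: runs_fwhile_next run1 run2; rewrite (stores_head Ts ltr).
- move=> c s t t' s' s'' le_t eq_s _ IH lec T Ts.
  have [T1 [run1 Ts1 agr1]] := IH lec T Ts.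
  exists T1; split=> //; first exact: runs_le run1.
  by move=> r ltr; have [j] := Ts1 r ltr; exists j; rewrite -eq_s.
Qed.

End Compile.

(** Time bounds space, so a function computed in polynomial time has results of polynomial size;
    composition relies on this. *)
Lemma exec_size c s t s' : exec c s t s' -> forall r, size (s' r) <= size (s r) + t.
Proof.
elim=> {c s t s'} [r b s|r s|c d s t s1 t' s' _ IH _ IH'|p r c d s t s' _ _ IH
  |p r c d s t s' _ _ IH|p r c s _|p r c s t s1 t' s' _ _ IH _ IH'
  |c s t t' s' s'' le_t eq_s _ IH] i.
- by rewrite /upd; case: eqP => [->|_] /=; lia.
- by rewrite /upd; case: eqP => [->|_] /=; rewrite ?size_behead; lia.
- by have := IH i; have := IH' i; lia.
- by have := IH i; lia.
- by have := IH i; lia.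
- by lia.
- by have := IH i; have := IH' i; lia.
- by rewrite -eq_s; have := IH i; lia.
Qed.

(** * Elementary operations on words in registers *)

Lemma updE s r w : upd s r w r = w.
Proof. by rewrite /upd eqxx. Qed.

Definition Nop := While xpred0 0 (Pop 0).

Lemma exec_nop s : exec Nop s 1 s.
Proof. exact: exec_while_end. Qed.

Definition pushes (l : seq (nat * bool)) : cmd :=
  foldr (fun p => Seq (Push p.1 p.2)) Nop l.

Definition pushed r (l : seq (nat * bool)) := [seq p.2 | p <- l & p.1 == r].

Lemma pushed_word r i w :
  pushed i [seq (r, b) | b <- w] = if i == r then w else [::].
Proof.
rewrite eq_sym; case: eqP => [<-|/eqP/negPf neq]; last first.
  by elim: w => //= b w; rewrite /pushed /= neq.
by elim: w => //= b w {2}<-; rewrite /pushed /= eqxx.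
Qed.

Lemma exec_pushes l s :
  exec (pushes l) s (3 * size l + 1) (fun i => rev (pushed i l) ++ s i).
Proof.
elim: l s => [|[r b] l IH] s /=; first exact: exec_nop.
apply: exec_weaken (exec_seq (exec_push r b s) (IH _)); first by lia.
move=> i; rewrite /upd /pushed /= [r == i]eq_sym.
by case: eqP => [->|_] //=; rewrite rev_cons cat_rcons.
Qed.

Lemma exec_push_word r w s : s r = [::] ->
  exec (pushes [seq (r, b) | b <- rev w]) s (3 * size w + 1) (upd s r w).
Proof.
move=> sr; apply: exec_weaken (exec_pushes _ s).
  by rewrite size_map size_rev.
by move=> i; rewrite pushed_word /upd; case: eqP => // ->; rewrite revK sr cats0.
Qed.

(** Clearing, moving, copying and encoding share this shape: empty [r] and push a list of bits that
    depends on the bit just popped. As long as nothing is pushed back onto [r], the number of rounds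
    is its length. *)
Definition loop r (h : bool -> seq (nat * bool)) : cmd :=
  While isSome r (If (pred1 (Some true)) r (Seq (Pop r) (pushes (h true)))
                                           (Seq (Pop r) (pushes (h false)))).

Lemma exec_loop r h n s :
  (forall b, pushed r (h b) = [::] /\ size (h b) <= n) ->
  exec (loop r h) s ((3 * n + 5) * size (s r) + 1)
    (fun i => if i == r then [::]
              else rev (flatten [seq pushed i (h b) | b <- s r]) ++ s i).
Proof.
move=> hP; move def_w: (s r) => w; elim: w s def_w => [|b w IH] s def_w.
  apply: exec_weaken (@exec_while_end isSome r _ s _) => //.
    by rewrite addn1.
    by move=> i; case: eqP => // ->.
  by rewrite def_w.
set s1 := fun i => rev (pushed i (h b)) ++ upd s r w i.
have s1r : s1 r = w by rewrite /s1 (proj1 (hP b)) updE.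
have run : exec (If (pred1 (Some true)) r (Seq (Pop r) (pushes (h true)))
    (Seq (Pop r) (pushes (h false)))) s (3 * n + 3) s1.
  have run : exec (Seq (Pop r) (pushes (h b))) s (3 * n + 2) s1.
    have := exec_seq (exec_pop r s) (exec_pushes (h b) _).
    apply: exec_weaken; last by rewrite def_w.
    by have [_] := hP b; lia.
  rewrite (_ : 3 * n + 3 = (3 * n + 2).+1); last by lia.
  case: b def_w @s1 s1r run => def_w s1 s1r run.
    by apply: exec_ifT; rewrite ?def_w.
  by apply: exec_ifF; rewrite ?def_w.
apply: exec_weaken (exec_while_next _ run (IH s1 s1r)).
- by rewrite /=; lia.
- move=> i; rewrite /s1 /upd; case: eqP => // _.
  by rewrite /= rev_cat -catA.
- by rewrite def_w.
Qed.

Lemma flatten_pushed0 i (h : bool -> seq (nat * bool)) w :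
  (forall b, pushed i (h b) = [::]) -> flatten [seq pushed i (h b) | b <- w] = [::].
Proof. by move=> h0; elim: w => //= b w ->; rewrite h0. Qed.

Lemma flatten_pushed1 i (h : bool -> seq (nat * bool)) w :
  (forall b, pushed i (h b) = [:: b]) -> flatten [seq pushed i (h b) | b <- w] = w.
Proof. by move=> h1; elim: w => //= b w ->; rewrite h1. Qed.

Definition clear r := loop r (fun=> [::]).

Lemma exec_clear r s : exec (clear r) s (5 * size (s r) + 1) (upd s r [::]).
Proof.
apply: exec_weaken (@exec_loop r _ 0 s _) => // i.
by rewrite /upd flatten_pushed0.
Qed.

Definition rev_move r r' := loop r (fun b => [:: (r', b)]).

Lemma exec_rev_move r r' s v w : r' != r -> s r = v -> s r' = w ->
  exec (rev_move r r') s (8 * size v + 1) (upd (upd s r [::]) r' (rev v ++ w)).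
Proof.
move=> neq <- <-; apply: exec_weaken (@exec_loop r _ 1 s _) => //.
  move=> i; rewrite /upd; case: (i =P r) => [->|neqi].
    by rewrite eq_sym (negPf neq).
  case: eqP => [->|neqi'].
    by rewrite flatten_pushed1 // => b; rewrite /pushed /= eqxx.
  rewrite flatten_pushed0 // => b.
  by rewrite /pushed /= eq_sym; case: eqP neqi'.
by move=> b; rewrite /pushed /= (negPf neq).
Qed.

Definition rev_copy r r1 r2 := loop r (fun b => [:: (r1, b); (r2, b)]).

Lemma exec_rev_copy r r1 r2 s v : uniq [:: r; r1; r2] -> s r = v ->
  s r1 = [::] -> s r2 = [::] ->
  exec (rev_copy r r1 r2) s (11 * size v + 1)
    (upd (upd (upd s r [::]) r1 (rev v)) r2 (rev v)).
Proof.
rewrite /= !inE andbT negb_or => /andP[/andP[n1 n2] n12] <- e1 e2.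
apply: exec_weaken (@exec_loop r _ 2 s _) => //.
  move=> i; rewrite /upd; case: (i =P r) => [->|neqi].
    by rewrite (negPf n1) (negPf n2).
  case: (i =P r2) => [->|neqi2].
    rewrite e2 cats0 flatten_pushed1 // => b.
    by rewrite /pushed /= (negPf n12) eqxx.
  case: (i =P r1) => [->|neqi1].
    rewrite e1 cats0 flatten_pushed1 // => b.
    by rewrite /pushed /= eqxx eq_sym (negPf n12).
  rewrite flatten_pushed0 // => b; rewrite /pushed /=.
  by rewrite ![_ == i]eq_sym; do !case: eqP => //.
move=> b; rewrite /pushed /= [r1 == r]eq_sym (negPf n1).
by rewrite [r2 == r]eq_sym (negPf n2).
Qed.

(* Prepends to register [r'] the encoding of the reversal of register [r]. *)
Definition encode r r' :=
  Seq (Push r' false) (loop r (fun b => [:: (r', b); (r', true)])).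

Lemma enc_word_rcons_rev w l :
  rev (flatten [seq [:: b; true] | b <- w]) ++ false :: l = enc_word (rev w) ++ l.
Proof.
rewrite /enc_word cat_rcons; congr (_ ++ _).
elim: w => //= b w IH.
by rewrite [rev (b :: w)]rev_cons map_rcons flatten_rcons -IH !rev_cons -!cats1 -catA.
Qed.

Lemma exec_encode r r' s v l : r' != r -> s r = rev v -> s r' = l ->
  exec (encode r r') s (11 * size v + 4)
    (upd (upd s r [::]) r' (enc_word v ++ l)).
Proof.
move=> neq er er'.
have neq' : r == r' = false by rewrite eq_sym (negPf neq).
apply: exec_weaken (exec_seq (exec_push r' false s) (@exec_loop r _ 2 _ _)).
- by rewrite /upd neq' er size_rev; lia.
- move=> i; rewrite /upd /pushed neq' /=.
  case: (i =P r) => [->|neqi]; first by rewrite neq'.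
  case: (i =P r') => [->|neqi'].
    rewrite er er' -[v in RHS]revK -enc_word_rcons_rev.
    by congr (rev (flatten _) ++ _); apply: eq_map => b; rewrite eqxx.
  have /negPf ni : r' != i by apply/eqP => eqi; apply: neqi'.
  by rewrite ni; elim: (s r).
- by move=> b; rewrite /pushed /= (negPf neq).
Qed.

(* Removes an encoded word from [r], pushing its reversal onto [r']. *)
Definition decode r r' :=
  Seq (While (pred1 (Some true)) r
        (Seq (Pop r)
          (Seq (If (pred1 (Some true)) r (Push r' true) (Push r' false)) (Pop r))))
      (Pop r).

Lemma exec_decode r r' s v l w : r' != r -> s r = enc_word v ++ l -> s r' = w ->
  exec (decode r r') s (7 * size v + 2) (upd (upd s r l) r' (rev v ++ w)).
Proof.
move=> neq; have neq' : r == r' = false by rewrite eq_sym (negPf neq).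
suff run s1 w1 : s1 r = enc_word v ++ l -> s1 r' = w1 ->
  exec (While (pred1 (Some true)) r (Seq (Pop r)
    (Seq (If (pred1 (Some true)) r (Push r' true) (Push r' false)) (Pop r))))
    s1 (7 * size v + 1) (upd (upd s1 r (false :: l)) r' (rev v ++ w1)).
  move=> er er'; apply: exec_weaken (exec_seq (run s w er er') (exec_pop r _)).
    by lia.
  move=> i; rewrite /upd eqxx neq' /=.
  by case: eqP => // ->; rewrite neq'.
elim: v s1 w1 => [|b v IH] s1 w1 er er'.
  apply: exec_weaken (exec_while_end _ _) => //; last by rewrite er.
  move=> i; rewrite /upd; case: eqP => [->|_]; first by rewrite er'.
  by case: eqP => [->|].
have run1 := exec_pop r s1.
have hd1 : upd s1 r (behead (s1 r)) r = b :: enc_word v ++ l by rewrite updE er.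
have run2 : exec (If (pred1 (Some true)) r (Push r' true) (Push r' false))
    (upd s1 r (behead (s1 r))) 4
    (upd (upd s1 r (behead (s1 r))) r' (b :: w1)).
  have er2 : upd s1 r (behead (s1 r)) r' = w1 by rewrite /upd (negPf neq).
  rewrite -er2; case: b {er} hd1 => hd1.
    by apply: exec_ifT (exec_push _ _ _); rewrite hd1.
  by apply: exec_ifF (exec_push _ _ _); rewrite hd1.
have run3 := exec_seq run1 (exec_seq run2 (exec_pop r _)).
apply: exec_weaken (exec_while_next _ run3 (IH _ (b :: w1) _ _)).
- by rewrite /=; lia.
- move=> i; rewrite /upd; case: (i =P r') => [_|_].
    by rewrite rev_cons cat_rcons.
  by case: eqP.
- by rewrite er.
- by rewrite updE {1}/upd neq' hd1.
- by rewrite /upd (negPf neq) eqxx.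
Qed.

(** * Polynomial-time functions between encoded types *)

Structure etype := EType { esort :> Type; enc : esort -> seq bool }.

(* Words that are encoded as they are, whereas a list of booleans is encoded
   element by element. *)
Record word := Word { bits_of_word : seq bool }.

Canonical bool_etype := EType (fun b : bool => [:: b]).
Canonical unit_etype := EType (fun _ : unit => [::]).
Canonical word_etype := EType bits_of_word.
(** Unary, because these numbers only count alternatives and positions; scores may be exponentially
    large and are kept as lists of bits. With [false] as the digit, [n] has the same encoding as a
    list of [n] units, so that iteration reduces to a fold. *)
Canonical nat_etype := EType (fun n => nseq n false).
(** Only the first component is delimited. Hence what remains after decoding one word is itself an
    encoded value, without any conversion. *)
Canonical prod_etype (X Y : etype) :=
  EType (fun p : X * Y => enc_word (enc p.1) ++ enc p.2).
Canonical seq_etype (X : etype) :=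
  EType (fun l : seq X => enc_words [seq enc x | x <- l]).

Lemma size_enc_word w : size (enc_word w) = (2 * size w).+1.
Proof. by rewrite size_rcons; elim: w => //= b w; lia. Qed.

Lemma enc_cons (X : etype) (x : X) l : enc (x :: l) = enc (x, l).
Proof. by []. Qed.

Lemma size_enc_pair (X Y : etype) (p : X * Y) :
  size (enc p) = 2 * size (enc p.1) + size (enc p.2) + 1.
Proof. by rewrite size_cat size_enc_word; lia. Qed.

Lemma size_seq_enc (X : etype) (l : seq X) : size l <= size (enc l).
Proof.
elim: l => // x l IH; rewrite enc_cons size_enc_pair.
by rewrite [size _]/= [(x, l).2]/=; lia.
Qed.

Lemma size_enc_drop (X : etype) (l : seq X) i : size (enc (drop i l)) <= size (enc l).
Proof.
elim: l i => [|x l IH] [|i] //; apply: leq_trans (IH i) _.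
by rewrite [in leqRHS]enc_cons size_enc_pair [(x, l).2]/=; lia.
Qed.

(* Registers [1 .. K] are scratch registers: empty before and after the run. *)
Definition ptime (X Y : etype) (f : X -> Y) :=
  exists c K k, forall x s, s 0 = enc x -> (forall i, 0 < i <= K -> s i = [::]) ->
    exec c s ((size (enc x)).+2 ^ k) (upd s 0 (enc (f x))).

Lemma ptimeI (X Y : etype) (f : X -> Y) c K T : poly_bounded T ->
  (forall x s, s 0 = enc x -> (forall i, 0 < i <= K -> s i = [::]) ->
     exec c s (T (size (enc x))) (upd s 0 (enc (f x)))) ->
  ptime f.
Proof.
move=> [k le_T] run; exists c, K, k => x s s0 sK.
exact: exec_weaken (le_T _) _ (run x s s0 sK).
Qed.

Lemma ptime_size (X Y : etype) (f : X -> Y) : ptime f ->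
  exists k, forall x, size (enc (f x)) <= (size (enc x)).+2 ^ k.
Proof.
case=> c [K [k run]].
have [l le_l] : poly_bounded (fun n => n + n.+2 ^ k) by poly_bound.
exists l => x; apply: leq_trans (le_l _).
set s := upd (fun=> [::]) 0 (enc x).
have sK i : 0 < i <= K -> s i = [::] by case: i.
exact: exec_size (run x s (updE _ _ _) sK) 0.
Qed.

Lemma eq_ptime (X Y : etype) (f g : X -> Y) : f =1 g -> ptime f -> ptime g.
Proof.
move=> eq_fg [c [K [k run]]]; exists c, K, k => x s s0 sK.
by rewrite -eq_fg; apply: run.
Qed.

(** A program sees encodings only, so it also computes any function between other types whose
    encodings coincide. *)
Lemma ptime_recode (X X' Y Y' : etype) (f : X -> Y) (f' : X' -> Y') (h : X' -> X) :
  (forall x, enc (h x) = enc x) -> (forall x, enc (f (h x)) = enc (f' x)) ->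
  ptime f -> ptime f'.
Proof.
move=> eq_h eq_f [c [K [k run]]]; exists c, K, k => x s s0 sK.
by rewrite -eq_f -eq_h; apply: run; rewrite ?eq_h.
Qed.

Lemma ptime_same (X Y : etype) (f : X -> Y) :
  (forall x, enc (f x) = enc x) -> ptime f.
Proof.
move=> eq_f; apply: (@ptimeI _ _ f Nop 0 (fun=> 1)) => [|x s s0 _].
  by poly_bound.
apply: exec_weaken (exec_nop s) => // i.
by rewrite /upd eq_f; case: eqP => // ->.
Qed.

Lemma ptime_id (X : etype) : ptime (fun x : X => x).
Proof. exact: ptime_same. Qed.

Ltac regs := move=> *; rewrite /upd; repeat (case: eqP => ? //=; try lia);
  subst; rewrite ?cats0 ?revK //; try solve [eauto | lia].

Lemma ptime_comp (X Y Z : etype) (g : Y -> Z) (f : X -> Y) :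
  ptime g -> ptime f -> ptime (fun x => g (f x)).
Proof.
move=> [c' [K' [k' run']]] pf; have [l size_f] := ptime_size pf.
have [c [K [k run]]] := pf.
apply: (@ptimeI _ _ _ (Seq c c') (maxn K K')
  (fun n => n.+2 ^ k + (n.+2 ^ l).+2 ^ k')); first by poly_bound.
move=> x s s0 sK.
have sK1 i : 0 < i <= K -> s i = [::] by move=> ?; apply: sK; lia.
have run1 := run x s s0 sK1.
have run2 : exec c' (upd s 0 (enc (f x))) ((size (enc (f x))).+2 ^ k')
    (upd (upd s 0 (enc (f x))) 0 (enc (g (f x)))).
  by apply: run' => [|i iK]; rewrite ?updE //; regs; apply: sK; lia.
apply: exec_weaken (exec_seq run1 run2).
- by rewrite leq_add2l leq_expl // !ltnS.
- by regs.
Qed.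

Lemma ptime_const (X Y : etype) (y : Y) : ptime (fun _ : X => y).
Proof.
apply: (@ptimeI _ _ _ (Seq (clear 0) (pushes [seq (0, b) | b <- rev (enc y)])) 0
  (fun n => 5 * n + 1 + (3 * size (enc y) + 1))); first by poly_bound.
move=> x s s0 _.
apply: exec_weaken (exec_seq (exec_clear 0 s) (exec_push_word _ _)) => //.
  by rewrite s0.
by regs.
Qed.

Lemma ptime_fst_prod (X Y : etype) : ptime (fun p : X * Y => p.1).
Proof.
apply: (@ptimeI _ _ _ (Seq (decode 0 1) (Seq (clear 0) (rev_move 1 0))) 1
  (fun n => (7 * n + 2) + ((5 * n + 1) + (8 * n + 1)))); first by poly_bound.
move=> [x y] s s0 sK.
have run1 := @exec_decode 0 1 s (enc x) (enc y) [::] isT s0 (sK 1 isT).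
have run2 := exec_clear 0 (upd (upd s 0 (enc y)) 1 (rev (enc x) ++ [::])).
have run3 := @exec_rev_move 1 0
  (upd (upd (upd s 0 (enc y)) 1 (rev (enc x) ++ [::])) 0 [::]) _ _ isT erefl erefl.
apply: exec_weaken (exec_seq run1 (exec_seq run2 run3)).
  rewrite /= /upd /= cats0 size_rev; have := size_enc_pair (x, y); rewrite /=; lia.
have s1 := sK 1 isT.
by regs.
Qed.

Lemma ptime_snd_prod (X Y : etype) : ptime (fun p : X * Y => p.2).
Proof.
apply: (@ptimeI _ _ _ (Seq (decode 0 1) (clear 1)) 1
  (fun n => (7 * n + 2) + (5 * n + 1))); first by poly_bound.
move=> [x y] s s0 sK.
have run1 := @exec_decode 0 1 s (enc x) (enc y) [::] isT s0 (sK 1 isT).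
have run2 := exec_clear 1 (upd (upd s 0 (enc y)) 1 (rev (enc x) ++ [::])).
apply: exec_weaken (exec_seq run1 run2).
  rewrite /= /upd /= cats0 size_rev; have := size_enc_pair (x, y); rewrite /=; lia.
have s1 := sK 1 isT.
by regs.
Qed.

Lemma ptime_pair (X Y Z : etype) (f : X -> Y) (g : X -> Z) :
  ptime f -> ptime g -> ptime (fun x => (f x, g x)).
Proof.
move=> pf [c' [K' [k' run']]]; have [l size_f] := ptime_size pf.
have [c [K1 [k run]]] := pf; set K := maxn K1 K'.
(* Neither program touches the registers above [K]: [K.+2] keeps the input while the first one runs,
   [K.+1] keeps its result while the second one runs. *)
apply: (@ptimeI _ _ _
  (Seq (rev_copy 0 K.+1 K.+2) (Seq (rev_move K.+1 0) (Seq c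
    (Seq (rev_move 0 K.+1) (Seq (rev_move K.+2 0) (Seq c' (encode K.+1 0)))))))
  K.+2 (fun n => (11 * n + 1) + ((8 * n + 1) + (n.+2 ^ k +
     ((8 * n.+2 ^ l + 1) + ((8 * n + 1) + (n.+2 ^ k' + (11 * n.+2 ^ l + 4))))))));
  first by poly_bound.
move=> x s s0 sK; set n := size (enc x).
have run1 := @exec_rev_copy 0 K.+1 K.+2 s (enc x).
set s1 := upd _ _ _ in run1.
have run2 := @exec_rev_move K.+1 0 s1 (rev (enc x)) [::] isT.
set s2 := upd _ _ _ in run2.
have run3 := run x s2; set s3 := upd _ _ _ in run3.
have run4 := @exec_rev_move 0 K.+1 s3 (enc (f x)) [::] isT.
set s4 := upd _ _ _ in run4.
have run5 := @exec_rev_move K.+2 0 s4 (rev (enc x)) [::] isT.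
set s5 := upd _ _ _ in run5.
have run6 := run' x s5; set s6 := upd _ _ _ in run6.
have run7 := @exec_encode K.+1 0 s6 (enc (f x)) (enc (g x)) isT.
have sM : s K.+1 = [::] by apply: sK; lia.
have sM' : s K.+2 = [::] by apply: sK; lia.
have sK' i : 0 < i <= K -> s i = [::] by move=> ?; apply: sK; lia.
apply: exec_weaken (exec_seq (run1 _ _ _ _) (exec_seq (run2 _ _)
  (exec_seq (run3 _ _) (exec_seq (run4 _ _) (exec_seq (run5 _ _)
   (exec_seq (run6 _ _) (run7 _ _))))))) => //; rewrite /s6 /s5 /s4 /s3 /s2 /s1.
1: rewrite !size_rev; have := size_f x; rewrite -/n; lia.
all: try solve [regs].
- by rewrite /= !inE; lia.
- by regs; apply: sK; lia.
- by regs; apply: sK; lia.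
Qed.

Lemma ptime_if_prod (X Y : etype) (f g : X -> Y) :
  ptime f -> ptime g -> ptime (fun p : bool * X => if p.1 then f p.2 else g p.2).
Proof.
move=> [c [K [k run]]] [c' [K' [k' run']]].
(* [enc (b, x)] is [true :: b :: false :: enc x]. *)
apply: (@ptimeI _ _ _ (Seq (Pop 0) (If (pred1 (Some true)) 0
    (Seq (Pop 0) (Seq (Pop 0) c)) (Seq (Pop 0) (Seq (Pop 0) c')))) (maxn K K')
  (fun n => n.+2 ^ k + n.+2 ^ k' + 4)); first by poly_bound.
move=> [b x] s s0 sK; set s1 := upd s 0 (enc x).
have exec_pops d t s' : exec d s1 t s' ->
    exec (Seq (Pop 0) (Seq (Pop 0) d)) (upd s 0 (behead (s 0))) (1 + (1 + t)) s'.
  move=> run_d; apply: exec_seq (exec_pop _ _) _.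
  apply: exec_seq _ run_d; apply: exec_weaken (exec_pop _ _) => //.
  by move=> i; rewrite /s1 /upd s0; case: eqP.
have le_exp j : (size (enc x)).+2 ^ j <= (size (enc (b, x))).+2 ^ j.
  by rewrite leq_expl // size_enc_pair /=; lia.
have hd : ohead (upd s 0 (behead (s 0)) 0) = Some b by rewrite updE s0.
have s1K i : 0 < i <= maxn K K' -> s1 i = [::].
  by move=> iK; rewrite /s1 /upd; case: eqP iK => [->|_] // /sK.
case: b s0 le_exp hd => s0 le_exp hd.
  have run1 : exec c s1 ((size (enc x)).+2 ^ k) (upd s1 0 (enc (f x))).
    by apply: run => [|i iK]; [apply: updE | apply: s1K; lia].
  apply: exec_weaken (exec_seq (exec_pop 0 s) (exec_ifT _ _ (exec_pops _ _ _ run1))).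
  - by have := le_exp k; lia.
  - by rewrite /s1; regs.
  - by rewrite hd.
have run1 : exec c' s1 ((size (enc x)).+2 ^ k') (upd s1 0 (enc (g x))).
  by apply: run' => [|i iK]; [apply: updE | apply: s1K; lia].
apply: exec_weaken (exec_seq (exec_pop 0 s) (exec_ifF _ _ (exec_pops _ _ _ run1))).
- by have := le_exp k'; lia.
- by rewrite /s1; regs.
- by rewrite hd.
Qed.

(* [enc (a :: l)] is [enc (a, l)], so only the empty list needs any action. *)
Lemma ptime_uncons (X : etype) (d : X) :
  ptime (fun l : seq X => (head d l, behead l)).
Proof.
apply: (@ptimeI _ _ _ (If isSome 0 Nop
  (pushes [seq (0, b) | b <- rev (enc (d, [::] : seq X))])) 0
  (fun n => 3 * size (enc (d, [::] : seq X)) + 3)); first by poly_bound.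
move=> [|a l] s s0 _.
  apply: exec_weaken (exec_ifF _ _ (exec_push_word _ _)) => //; last by rewrite s0.
  by lia.
have s0' : s 0 = enc_word (enc a) ++ enc l by [].
apply: exec_weaken (exec_ifT _ _ (exec_nop s)).
- by lia.
- by move=> i; rewrite /upd; case: eqP => // ->.
- by rewrite s0'; case: (enc a).
Qed.

(** Each bit [b] turns into [enc_word [:: b]], that is [true, b, false], pushed starting with its
    last bit. *)
Lemma ptime_bits_word : ptime bits_of_word.
Proof.
apply: (@ptimeI _ _ bits_of_word (Seq (rev_move 0 1)
    (loop 1 (fun b => [:: (0, false); (0, b); (0, true)]))) 1
  (fun n => (8 * n + 1) + (14 * n + 1))); first by poly_bound.
move=> [w] s s0 sK.
have run1 := @exec_rev_move 0 1 s w [::] isT s0 (sK 1 isT).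
have s1 := sK 1 isT.
apply: exec_weaken (exec_seq run1 (@exec_loop 1 _ 3 _ _)) => //.
  by rewrite updE cats0 size_rev /=; lia.
move=> i; rewrite updE /upd cats0.
case: (i =P 1) => [->|ni] //=.
case: (i =P 0) => [->|ni0].
  rewrite cats0 /= /enc_words -[RHS]revK; congr rev.
  rewrite /= -map_comp; elim: w {run1 s0} => //= b w IH.
  by rewrite rev_cons map_rcons flatten_rcons IH /= !rev_cons -!cats1 -!catA.
rewrite flatten_pushed0 // => b; rewrite /pushed /=.
by rewrite [0 == i]eq_sym; case: eqP.
Qed.

(** Polynomial time for one step is not enough, since a size that doubles in every round explodes;
    hence the bound on the accumulators reached after all prefixes. *)
Lemma ptime_foldl_prod (A B : etype) (f : B * A -> B) : ptime f ->
  (exists q, forall b (l : seq A) i,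
     size (enc (foldl (fun b a => f (b, a)) b (take i l)))
       <= (size (enc (b, l))).+2 ^ q) ->
  ptime (fun p : B * seq A => foldl (fun b a => f (b, a)) p.1 p.2).
Proof.
move=> [c [K [k run]]] [q bound].
(* Between rounds register 0 holds the remaining list and [K.+1] the reversed accumulator. During a
   round [K.+2] receives the reversed first element and [K.+3] stores the reversed tail. Encodings
   of elements are delimited by non-empty words, so an empty register 0 means an empty list. *)
pose body := Seq (decode 0 K.+2) (Seq (rev_move 0 K.+3) (Seq (rev_move K.+2 0)
  (Seq (encode K.+1 0) (Seq c (Seq (rev_move 0 K.+1) (rev_move K.+3 0)))))).
(* If the accumulator and the list have size at most [N], the pair passed to [c] has size at most
   [3 * N + 1]; the linear part generously covers the moves of words. *)
pose T N := 50 * N + 20 + (3 * N + 1).+2 ^ k.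
have run_loop N b l s : size (enc l) <= N ->
    (forall i, size (enc (foldl (fun b a => f (b, a)) b (take i l))) <= N) ->
    s 0 = enc l -> s K.+1 = rev (enc b) ->
    (forall i, 0 < i <= K.+3 -> i != K.+1 -> s i = [::]) ->
    exec (While isSome 0 body) s (size l * T N + 1)
      (upd (upd s 0 [::]) K.+1 (rev (enc (foldl (fun b a => f (b, a)) b l)))).
  elim: l b s => [|a l IH] b s leN leb s0 sM sK.
    apply: exec_weaken (exec_while_end _ _) => //; last by rewrite s0.
    by move=> i; regs.
  have s0' : s 0 = enc_word (enc a) ++ enc l by [].
  have {}leN : 2 * size (enc a) + size (enc l) < N.
    by have := leN; rewrite enc_cons size_enc_pair /=; lia.
  have s2 : s K.+2 = [::] by apply: sK; lia.
  have s3 : s K.+3 = [::] by apply: sK; lia.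
  have sK' i : 0 < i <= K -> s i = [::] by move=> ?; apply: sK; lia.
  have run1 := @exec_decode 0 K.+2 s (enc a) (enc l) [::] isT s0' s2.
  set s_1 := upd _ _ _ in run1.
  have run2 := @exec_rev_move 0 K.+3 s_1 (enc l) [::] isT.
  set s_2 := upd _ _ _ in run2.
  have run3 := @exec_rev_move K.+2 0 s_2 (rev (enc a)) [::] isT.
  set s_3 := upd _ _ _ in run3.
  have run4 := @exec_encode K.+1 0 s_3 (enc b) (enc a) isT.
  set s_4 := upd _ _ _ in run4.
  have run5 := run (b, a) s_4.
  set s_5 := upd _ _ _ in run5.
  have run6 := @exec_rev_move 0 K.+1 s_5 (enc (f (b, a))) [::] isT.
  set s_6 := upd _ _ _ in run6.
  have run7 := @exec_rev_move K.+3 0 s_6 (rev (enc l)) [::] isT.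
  set s_7 := upd _ _ _ in run7.
  have := leb 0; rewrite take0 /= => leb0.
  have := leb 1; rewrite /= take0 /= => leb1.
  have run_body : exec body s (T N - 1) s_7.
    apply: exec_weaken (exec_seq run1 (exec_seq (run2 _ _)
      (exec_seq (run3 _ _) (exec_seq (run4 _ _) (exec_seq (run5 _ _)
      (exec_seq (run6 _ _) (run7 _ _))))))) => //;
      rewrite /s_7 /s_6 /s_5 /s_4 /s_3 /s_2 /s_1.
    - rewrite !size_rev.
      have : (size (enc (b, a))).+2 ^ k <= (3 * N + 1).+2 ^ k.
        by rewrite leq_expl // size_enc_pair /=; lia.
      by rewrite /T; lia.
    all: try solve [regs].
  apply: exec_weaken (exec_while_next _ run_body (IH (f (b, a)) _ _ _ _ _ _)).
  - by rewrite /= /T; lia.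
  - rewrite /s_7 /s_6 /s_5 /s_4 /s_3 /s_2 /s_1 => i; regs.
  - by rewrite s0'; case: (enc a).
  - by lia.
  - by move=> i; apply: leb i.+1.
  - by rewrite /s_7; regs.
  - by rewrite /s_7 /s_6; regs.
  - rewrite /s_7 /s_6 /s_5 /s_4 /s_3 /s_2 /s_1 => i ? /eqP ?; regs.
    by apply: sK; [lia | apply/eqP].
pose N n := n + n.+2 ^ q.
apply: (@ptimeI _ _ _ (Seq (decode 0 K.+1) (Seq (While isSome 0 body)
   (rev_move K.+1 0))) K.+3
  (fun n => (7 * n + 2) + ((n * T (N n) + 1) + (8 * N n + 1)))).
  by rewrite /T /N; poly_bound.
move=> [b l] s s0 sK; set n := size (enc (b, l)).
have run1 := @exec_decode 0 K.+1 s (enc b) (enc l) [::] isT s0 (sK K.+1 _).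
set s1 := upd _ _ _ in run1.
have leb i := bound b l i.
have size_n : n = 2 * size (enc b) + size (enc l) + 1 by rewrite /n size_enc_pair.
have run2 := run_loop (N n) b l s1.
set s2 := upd _ _ _ in run2.
have run3 := @exec_rev_move K.+1 0 s2 (rev (enc (foldl (fun b a => f (b, a)) b l)))
  [::] isT.
have sM : s K.+1 = [::] by apply: sK; lia.
apply: exec_weaken (exec_seq (run1 _) (exec_seq (run2 _ _ _ _ _) (run3 _ _)));
  rewrite /s2 /s1.
- have leF : size (enc (foldl (fun b a => f (b, a)) b l)) <= N n.
    by have := leb (size l); rewrite take_size /N -/n; lia.
  have leT : size l * T (N n) <= n * T (N n).
    by rewrite leq_mul2r; have := size_seq_enc l; lia.
  rewrite size_rev -/n; apply: leq_add; first by lia.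
  by apply: leq_add; [rewrite leq_add2r | rewrite leq_add2r leq_mul2l].
all: try solve [regs].
- by rewrite /N; lia.
by move=> i; apply: leq_trans (leb i) _; rewrite /N leq_addl.
Qed.

(** * Closure rules for functions computed in polynomial time *)

Arguments enc : simpl never.

Lemma size_enc_bool (b : bool) : size (enc b) = 1.
Proof. by []. Qed.

Lemma size_enc_nat (n : nat) : size (enc n) = n.
Proof. exact: size_nseq. Qed.

Lemma size_enc_cons (X : etype) (x : X) l :
  size (enc (x :: l)) = 2 * size (enc x) + size (enc l) + 1.
Proof. by rewrite enc_cons size_enc_pair. Qed.

Lemma ptime_fst (X Y Z : etype) (f : X -> Y * Z) : ptime f -> ptime (fun x => (f x).1).
Proof. exact/ptime_comp/ptime_fst_prod. Qed.

Lemma ptime_snd (X Y Z : etype) (f : X -> Y * Z) : ptime f -> ptime (fun x => (f x).2).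
Proof. exact/ptime_comp/ptime_snd_prod. Qed.

Lemma ptime_if (X Y : etype) (b : X -> bool) (f g : X -> Y) :
  ptime b -> ptime f -> ptime g -> ptime (fun x => if b x then f x else g x).
Proof.
move=> pb pf pg.
exact: ptime_comp (ptime_if_prod pf pg) (ptime_pair pb (ptime_id X)).
Qed.

(** If a step adds to the accumulator an amount polynomial in the parameter and the current element
    alone, independently of the accumulator, the total growth is at most the length of the list
    times a polynomial. The parameter [x] travels inside the accumulator. *)
Lemma ptime_foldl (X A B : etype) (step : X -> B -> A -> B) (init : X -> B) (l : X -> seq A) :
  ptime (fun q : X * B * A => step q.1.1 q.1.2 q.2) ->
  (exists q, forall x b a,
     size (enc (step x b a)) <= size (enc b) + (size (enc (x, a))).+2 ^ q) ->
  ptime init -> ptime l -> ptime (fun x => foldl (step x) (init x) (l x)).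
Proof.
move=> pstep [q growth] pinit pl.
pose f (p : X * B * A) := (p.1.1, step p.1.1 p.1.2 p.2).
have foldE x b (l' : seq A) :
    foldl (fun b a => f (b, a)) (x, b) l' = (x, foldl (step x) b l').
  by elim: l' b => //= a l' IH b; rewrite IH.
have pf : ptime f by apply: ptime_pair => //; do !apply: ptime_fst; apply: ptime_id.
have bound x b (l' : seq A) i n : size (enc (x, l')) <= n ->
    size (enc (foldl (step x) b (take i l'))) <= size (enc b) + size l' * n.+2 ^ q.
  elim: l' b i => [|a l' IH] b [|i] len; rewrite /= ?take0; try by lia.
  have := len; rewrite size_enc_pair /= size_enc_cons => size_al.
  apply: leq_trans (IH (step x b a) i _) _; first by rewrite size_enc_pair /=; lia.
  have := growth x b a; have: (size (enc (x, a))).+2 ^ q <= n.+2 ^ q.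
    by apply: leq_expl; rewrite size_enc_pair /=; lia.
  by lia.
have pfold : ptime (fun p : X * B * seq A => foldl (fun b a => f (b, a)) p.1 p.2).
  apply: ptime_foldl_prod => //.
  have [k le_k] : poly_bounded (fun n => 2 * n + (n + n * (2 * n + 1).+2 ^ q) + 1).
    by poly_bound.
  exists k => -[x b] l' i; apply: leq_trans (le_k _); rewrite foldE size_enc_pair.
  set n := size (enc (x, b, l')).
  have := size_enc_pair (x, b, l'); rewrite -/n size_enc_pair /= => size_n.
  have le_l := size_seq_enc l'.
  have := bound x b l' i (2 * n + 1); rewrite size_enc_pair /= => le_b.
  have {}le_b := le_b ltac:(lia).
  have: size l' * (2 * n + 1).+2 ^ q <= n * (2 * n + 1).+2 ^ q.
    by rewrite leq_mul2r; lia.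
  by lia.
apply: (@eq_ptime _ _
  (fun x => (foldl (fun b a => f (b, a)) (x, init x) (l x)).2)) => [x|].
  by rewrite foldE.
apply: ptime_snd.
apply: (ptime_comp pfold (f := fun x => ((x, init x), l x))).
by do !apply: ptime_pair => //; apply: ptime_id.
Qed.

Lemma ptime_iter (X B : etype) (step : X -> B -> B) (init : X -> B) (n : X -> nat) :
  ptime (fun q : X * B => step q.1 q.2) ->
  (exists q, forall x b,
     size (enc (step x b)) <= size (enc b) + (size (enc x)).+2 ^ q) ->
  ptime init -> ptime n -> ptime (fun x => iter (n x) (step x) (init x)).
Proof.
move=> pstep [q growth] pinit pn.
have pu : ptime (fun x => nseq (n x) tt).
  apply: (ptime_recode (f := n) (h := id)) pn => // x /=.
  by rewrite /enc /= /enc_words map_nseq; elim: (n x) => //= m {1}->.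
apply: (@eq_ptime _ _ (fun x => foldl (fun b _ => step x b) (init x) (nseq (n x) tt))).
  by move=> x; elim: (n x) (init x) => // m IH b; rewrite iterSr /= IH.
apply: ptime_foldl => //.
  exact: ptime_comp pstep (ptime_fst (ptime_id _)).
exists q => x b []; apply: leq_trans (growth x b) _.
rewrite leq_add2l leq_expl // size_enc_pair /=; lia.
Qed.

Lemma ptime_comp2 (X Y Y' Z : etype) (g : Y -> Y' -> Z) (f : X -> Y) (f' : X -> Y') :
  ptime (fun q : Y * Y' => g q.1 q.2) -> ptime f -> ptime f' ->
  ptime (fun x => g (f x) (f' x)).
Proof. by move=> pg pf pf'; apply: ptime_comp pg (ptime_pair pf pf'). Qed.

Lemma ptime_cons (X A : etype) (a : X -> A) (l : X -> seq A) :
  ptime a -> ptime l -> ptime (fun x => a x :: l x).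
Proof. by apply: (ptime_comp2 (g := cons)); apply: ptime_same. Qed.

Lemma ptime_head (X A : etype) d (l : X -> seq A) :
  ptime l -> ptime (fun x => head d (l x)).
Proof. exact/ptime_comp/(ptime_fst (ptime_uncons d)). Qed.

Lemma ptime_behead (X A : etype) (d : A) (l : X -> seq A) :
  ptime l -> ptime (fun x => behead (l x)).
Proof. exact/ptime_comp/(ptime_snd (ptime_uncons d)). Qed.

Lemma ptime_negb (X : etype) (b : X -> bool) : ptime b -> ptime (fun x => ~~ b x).
Proof. by move=> pb; apply: (ptime_if pb); apply: ptime_const. Qed.

Lemma ptime_andb (X : etype) (b c : X -> bool) :
  ptime b -> ptime c -> ptime (fun x => b x && c x).
Proof. by move=> pb pc; apply: (ptime_if pb pc); apply: ptime_const. Qed.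

Lemma ptime_orb (X : etype) (b c : X -> bool) :
  ptime b -> ptime c -> ptime (fun x => b x || c x).
Proof. by move=> pb pc; apply: (ptime_if pb _ pc); apply: ptime_const. Qed.

Lemma ptime_addb (X : etype) (b c : X -> bool) :
  ptime b -> ptime c -> ptime (fun x => b x (+) c x).
Proof.
move=> pb pc; apply: eq_ptime (ptime_if pb (ptime_negb pc) pc) => x.
by case: (b x).
Qed.

Lemma ptime_succ (X : etype) (n : X -> nat) : ptime n -> ptime (fun x => (n x).+1).
Proof.
(* The encoding of [(tt, n)] is [false] followed by the encoding of [n], hence that of [n.+1]. *)
move=> pn; apply: (ptime_comp2 (g := fun (_ : unit) n => n.+1) (f := fun=> tt)) => //.
  exact: ptime_same.
exact: ptime_const.
Qed.

Lemma ptime_pred (X : etype) (n : X -> nat) : ptime n -> ptime (fun x => (n x).-1).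
Proof.
apply: ptime_comp.
(* On lists of units the predecessor is the tail, including the case of 0. *)
apply: (ptime_recode (f := @behead unit) (h := fun n => nseq n tt)) => [m|m|].
- by rewrite /enc /= /enc_words map_nseq; elim: m => //= m ->.
- by rewrite /enc /= /enc_words; case: m => //= m; rewrite map_nseq; elim: m => //= m ->.
exact/(ptime_behead tt)/ptime_id.
Qed.

(* Redefined once the rules for the remaining operations are available. *)
Ltac ptime_more := fail.

(** Follows the syntax of the function and leaves open the parts for which it has no rule; folds and
    case distinctions are applied by hand. *)
Ltac ptime := cbn beta; lazymatch goal with
  | |- ptime (fun x => x) => exact: ptime_id
  | |- ptime fst => exact: ptime_fst_prod
  | |- ptime snd => exact: ptime_snd_prod
  | |- ptime (fun x => (@?f x, @?g x)) => apply: ptime_pair; ptime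
  | |- ptime (fun x => (@?f x).1) => apply: ptime_fst; ptime
  | |- ptime (fun x => (@?f x).2) => apply: ptime_snd; ptime
  | |- ptime (fun x => @?a x :: @?l x) => apply: ptime_cons; ptime
  | |- ptime (fun x => ~~ @?b x) => apply: ptime_negb; ptime
  | |- ptime (fun x => @?b x && @?c x) => apply: ptime_andb; ptime
  | |- ptime (fun x => @?b x || @?c x) => apply: ptime_orb; ptime
  | |- ptime (fun x => @?b x (+) @?c x) => apply: ptime_addb; ptime
  | |- ptime (fun x => (@?n x).+1) => apply: ptime_succ; ptime
  | |- ptime (fun x => (@?n x).-1) => apply: ptime_pred; ptime
  | |- _ => first [assumption | exact: ptime_const | ptime_more | idtac]
  end.

Lemma ptime_add (X : etype) (m n : X -> nat) :
  ptime m -> ptime n -> ptime (fun x => m x + n x).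
Proof.
apply: (ptime_comp2 (g := addn)).
apply: (@eq_ptime _ _ (fun q : nat * nat => iter q.1 S q.2)).
  by move=> [i j] /=; elim: i => //= i ->.
apply: (@ptime_iter _ _ (fun=> S)); ptime.
by exists 0 => x b /=; rewrite !size_enc_nat; lia.
Qed.

Lemma ptime_sub (X : etype) (m n : X -> nat) :
  ptime m -> ptime n -> ptime (fun x => m x - n x).
Proof.
apply: (ptime_comp2 (g := subn)).
apply: (@eq_ptime _ _ (fun q : nat * nat => iter q.2 predn q.1)).
  by move=> [i j] /=; elim: j => /= [|j ->]; lia.
apply: (@ptime_iter _ _ (fun=> predn)); ptime.
by exists 0 => x b /=; rewrite !size_enc_nat; lia.
Qed.

Lemma ptime_mul (X : etype) (m n : X -> nat) :
  ptime m -> ptime n -> ptime (fun x => m x * n x).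
Proof.
apply: (ptime_comp2 (g := muln)).
apply: (@eq_ptime _ _ (fun q : nat * nat => iter q.1 (addn q.2) 0)).
  by move=> [i j] /=; rewrite iter_addn_0 mulnC.
apply: (@ptime_iter _ _ (fun q : nat * nat => addn q.2)); ptime.
  by apply: ptime_add; ptime.
by exists 1 => -[i j] b; rewrite size_enc_pair /= !size_enc_nat expn1; lia.
Qed.

Lemma ptime_drop (X A : etype) (d : A) (n : X -> nat) (l : X -> seq A) :
  ptime n -> ptime l -> ptime (fun x => drop (n x) (l x)).
Proof.
apply: (ptime_comp2 (g := drop)).
apply: (@eq_ptime _ _ (fun q : nat * seq A => iter q.1 behead q.2)).
  move=> [i s] /=; elim: i s => [|i IH] s; first by rewrite drop0.
  by rewrite iterSr IH -addn1 -drop_drop drop1.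
apply: (@ptime_iter _ _ (fun=> behead)); ptime.
  by apply: (ptime_behead d); ptime.
by exists 0 => x b; rewrite -drop1; have := size_enc_drop b 1; lia.
Qed.

Lemma ptime_nth (X A : etype) d (l : X -> seq A) (n : X -> nat) :
  ptime l -> ptime n -> ptime (fun x => nth d (l x) (n x)).
Proof.
move=> pl pn; apply: (@eq_ptime _ _ (fun x => head d (drop (n x) (l x)))).
  by move=> x; rewrite -nth0 nth_drop addn0.
exact/ptime_head/ptime_drop.
Qed.

Lemma ptime_rev (X A : etype) (l : X -> seq A) :
  ptime l -> ptime (fun x => rev (l x)).
Proof.
apply: ptime_comp.
apply: (@eq_ptime _ _ (fun l : seq A => foldl (fun b a => a :: b) [::] l)).
  by move=> l'; rewrite /rev; elim: l' [::] => //= a l1 IH b; rewrite IH.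
apply: (@ptime_foldl _ _ _ (fun _ b a => a :: b)); ptime.
exists 2 => x b a; rewrite size_enc_cons size_enc_pair /= expnS expn1; nia.
Qed.

Lemma ptime_map (X A B : etype) (f : X -> A -> B) (l : X -> seq A) :
  ptime (fun q : X * A => f q.1 q.2) -> ptime l ->
  ptime (fun x => [seq f x a | a <- l x]).
Proof.
move=> pf pl; apply: (@eq_ptime _ _
  (fun x => rev (foldl (fun b a => f x a :: b) [::] (l x)))).
  move=> x; rewrite -[RHS]revK; congr rev; rewrite -[RHS]cats0.
  by elim: (l x) [::] => //= a l' IH b; rewrite IH rev_cons cat_rcons.
apply: ptime_rev.
apply: (@ptime_foldl _ _ _ (fun x b a => f x a :: b)); ptime.
  by apply: (ptime_comp2 (f := fun q : X * seq B * A => q.1.1) (g := f)); ptime.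
have [k size_f] := ptime_size pf.
have [q le_q] : poly_bounded (fun n => 2 * n.+2 ^ k + 1) by poly_bound.
exists q => x b a; have := le_q (size (enc (x, a))); have /= := size_f (x, a).
by rewrite size_enc_cons; lia.
Qed.

Lemma ptime_all (X A : etype) (p : X -> pred A) (l : X -> seq A) :
  ptime (fun q : X * A => p q.1 q.2) -> ptime l -> ptime (fun x => all (p x) (l x)).
Proof.
move=> pp pl; apply: (@eq_ptime _ _
  (fun x => foldl (fun b a => b && p x a) true (l x))).
  move=> x; rewrite -[RHS]andTb.
  by elim: (l x) true => [b|a l' IH b] /=; rewrite ?andbT // IH andbA.
apply: (@ptime_foldl _ _ _ (fun x b a => b && p x a)); ptime.
  by apply: (ptime_comp2 (f := fun q : X * bool * A => q.1.1) (g := p)); ptime.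
by exists 0 => x b a; rewrite !size_enc_bool; lia.
Qed.

Lemma ptime_count (X A : etype) (p : X -> pred A) (l : X -> seq A) :
  ptime (fun q : X * A => p q.1 q.2) -> ptime l -> ptime (fun x => count (p x) (l x)).
Proof.
move=> pp pl; apply: (@eq_ptime _ _
  (fun x => foldl (fun n a => if p x a then n.+1 else n) 0 (l x))).
  move=> x; rewrite -[RHS]add0n.
  by elim: (l x) 0 => [n|a l' IH n] /=; rewrite ?addn0 // IH; case: (p x a); lia.
apply: (@ptime_foldl _ _ _ (fun x n a => if p x a then n.+1 else n)); ptime.
  apply: ptime_if; ptime.
  by apply: (ptime_comp2 (f := fun q : X * nat * A => q.1.1) (g := p)); ptime.
by exists 0 => x b a /=; case: (p x a); rewrite !size_enc_nat; lia.
Qed.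

Lemma ptime_size_seq (X A : etype) (l : X -> seq A) :
  ptime l -> ptime (fun x => size (l x)).
Proof.
move=> pl; apply: (@eq_ptime _ _ (fun x => count predT (l x))).
  by move=> x; rewrite count_predT.
by apply: (@ptime_count _ _ (fun=> predT)); ptime.
Qed.

Lemma ptime_iota0 (X : etype) (n : X -> nat) :
  ptime n -> ptime (fun x => iota 0 (n x)).
Proof.
apply: ptime_comp.
(* Counting down keeps the growth of the list bounded in terms of [n] alone. *)
apply: (@eq_ptime _ _ (fun n => iter n (fun b => (n - (size b).+1) :: b) [::])).
  move=> m; have: forall i, i <= m ->
      iter i (fun b => (m - (size b).+1) :: b) [::] = iota (m - i) i.
    elim=> // i IH lt_im; rewrite iterS IH ?size_iota; last by lia.
    by rewrite /= -subSn // subSS.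
  by move/(_ m (leqnn m)); rewrite subnn.
apply: (@ptime_iter _ _ (fun n b => (n - (size b).+1) :: b)); ptime.
  by apply: ptime_sub; ptime; apply: ptime_size_seq; ptime.
have [q le_q] : poly_bounded (fun n => 2 * n + 1) by poly_bound.
exists q => m b; have := le_q m; rewrite size_enc_cons !size_enc_nat; lia.
Qed.

Lemma ptime_bits (X : etype) (w : X -> word) :
  ptime w -> ptime (fun x => bits_of_word (w x)).
Proof. exact/ptime_comp/ptime_bits_word. Qed.

(** * From fragments to machines *)

Section MachineOfFragment.
Variables (W : finType) (N : nat) (F : fragment 'I_N.+1 W).

Definition machine_of_fragment : machine :=
  @Machine W (option (fstate F)) N (Some (fstart F)) (fun q => ~~ q)
    (fun q h => if q is Some q then fdelta q h else (None, nop_action h)).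

Lemma iter_step_halted (M : machine) (c : config M) t :
  halting (cstate c) -> iter t (@step M) c = c.
Proof. by move=> halt; elim: t => //= t ->; rewrite /step halt. Qed.

Lemma machine_of_fragmentP q T t T' : @reaches _ _ F q T t T' ->
  iter t (@step machine_of_fragment) (@Config machine_of_fragment (Some q) T)
  = @Config machine_of_fragment None T'.
Proof.
elim=> {q T t T'} [q T a [//|t] del _ | q T q' a t T' del _ IH].
  rewrite iterSr [step _](_ : _ = @Config machine_of_fragment None (act a T)).
    exact: iter_step_halted.
  by rewrite /step /= -/(heads_of T) del.
rewrite iterSr -IH; congr iter.
by rewrite /step /= -/(heads_of T) del.
Qed.

End MachineOfFragment.

Lemma size_read_bits (M : machine) (s : seq (cell (work M))) :
  size (read_bits s) <= size s.
Proof. by elim: s => //= -[[b|a]|] s IH. Qed.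

(** Only a move to the left lengthens the part right of the head, by one cell. This bounds the
    output of a machine by its input and its running time. *)
Lemma size_tright_iter (M : machine) (c : config M) t i :
  size (tright (ctapes (iter t (@step M) c) i)) <= size (tright (ctapes c i)) + t.
Proof.
elim: t => [|t IH]; first by rewrite addn0.
rewrite iterS addnS; move: (iter t _ c) IH => d IH.
suff: size (tright (ctapes (step d) i)) <= (size (tright (ctapes d i))).+1 by lia.
rewrite /step; case: ifP => // _.
case: (trans _ _) => q a /=; rewrite ffunE.
by case: (a i) => b [] //=; rewrite size_behead; lia.
Qed.

Lemma poly_bounded_horner (p : {poly nat}) : poly_bounded (fun n => p.[n]%R).
Proof.
elim/poly_ind: p => [|p c IH].
  by apply: poly_bounded_le (poly_bounded_const 0) => n; rewrite horner0.
apply: (poly_bounded_le (g := fun n => p.[n]%R * n + c)) => [n|]; last first.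
  by apply: poly_boundedD (poly_boundedM IH poly_bounded_id) (poly_bounded_const c).
by rewrite hornerD hornerC hornerMX.
Qed.

(** * Calling a given machine from a program *)

Section Oracle.
Variable M : machine.
Notation n := (ntapes M).
Notation W := (work M).
Variable R : nat.
Implicit Type T : {ffun 'I_(R + n).+1 -> tape (cell W)}.

Definition reg (r : nat) : 'I_(R + n).+1 := inord r.
(* Beyond the [R] register tapes come the tapes of [M]. *)
Definition oracle_tape (i : 'I_n.+1) : 'I_(R + n).+1 := inord (R + i).

Lemma regK r : r < R -> reg r = r :> nat.
Proof. by move=> ltr; rewrite inordK //; lia. Qed.

Lemma reg_inj : {in gtn R &, injective reg}.
Proof.
move=> r r' ltr ltr' /(congr1 (@nat_of_ord _)).
by rewrite !regK.
Qed.

Lemma reg_neq r r' : r < R -> r' < R -> r != r' -> reg r != reg r'.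
Proof. by move=> ltr ltr'; apply: contra => /eqP/reg_inj->. Qed.

Lemma oracle_tapeK i : oracle_tape i = R + i :> nat.
Proof. by rewrite inordK //; have := ltn_ord i; lia. Qed.

Lemma oracle_tape_reg i r : r < R -> oracle_tape i <> reg r.
Proof.
by move=> ltr /(congr1 (@nat_of_ord _)); rewrite oracle_tapeK regK //; lia.
Qed.

(** The output tape of [M] is thereby the output tape of the combined machine as well, while
    register 0 is its input tape. *)
Lemma oracle_tape_max : oracle_tape ord_max = ord_max.
Proof. by apply: val_inj; rewrite /= oracle_tapeK. Qed.

Lemma oracle_tape_inj : injective oracle_tape.
Proof.
by move=> i i' /(congr1 (@nat_of_ord _)); rewrite !oracle_tapeK => /addnI/val_inj.
Qed.

Definition foracle : fragment 'I_(R + n).+1 W :=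
  Fragment (start M) (fun q h =>
    if halting q then (None, nop_action h) else
    let: (q', a) := trans q [ffun i => h (oracle_tape i)] in
    (Some q', [ffun j : 'I__ => if R <= j then a (inord (j - R)) else (h j, Stay)])).

Lemma reaches_foracle t (c : config M) T :
  (forall i, T (oracle_tape i) = ctapes c i) ->
  halting (cstate (iter t (@step M) c)) ->
  exists T', [/\ @reaches _ _ foracle (cstate c) T t.+1 T',
    forall i, T' (oracle_tape i) = ctapes (iter t (@step M) c) i &
    forall r, r < R -> T' (reg r) = T (reg r)].
Proof.
elim: t c T => [|t IH] c T Tc halt.
  exists T; split=> //; rewrite -{2}[T]act_nop.
  by apply: reaches_exit => //=; rewrite /= in halt; rewrite halt.
case: (boolP (halting (cstate c))) => haltc.
  exists T; split=> //; last by rewrite iter_step_halted.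
  by rewrite -{2}[T]act_nop; apply: reaches_exit => //=; rewrite haltc.
rewrite iterSr in halt *.
have := erefl (step c); rewrite {2}/step (negPf haltc).
case del: (trans _ _) => [q a] def_c1.
pose A : {ffun 'I_(R + n).+1 -> cell W * move} :=
  [ffun j : 'I__ => if R <= j then a (inord (j - R)) else (heads_of T j, Stay)].
have [|T' [run T'E agr]] := IH (step c) (act A T) _ halt; last first.
  exists T'; split=> //.
    apply: reaches_step run; rewrite /= (negPf haltc).
    have -> : [ffun i => heads_of T (oracle_tape i)] = [ffun i => thead (ctapes c i)].
      by apply/ffunP => i; rewrite !ffunE Tc.
    by rewrite del def_c1.
  move=> r ltr; rewrite agr // /act /A !ffunE regK // leqNgt ltr /=.
  by case: (T _).
move=> i; rewrite def_c1 /act /A !ffunE oracle_tapeK leq_addr addKn inord_val.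
by rewrite Tc.
Qed.

Hypothesis R_gt1 : 1 < R.

(** Pushing reverses the word, which is harmless in unary. Nothing is ever popped from the tape of
    [M], so no blanks are recorded to the left and the result is literally the initial tape of
    [M]. *)
Definition fload : fragment 'I_(R + n).+1 W :=
  fseq (fwhile (fun h => bit_of (h (reg 0)) == Some true)
    (fseq (fpop W (reg 0)) (fseq (fpop W (reg 0)) (fpush W (oracle_tape ord0) true))))
   (fpop W (reg 0)).

Lemma runs_fload T k l w :
  T (reg 0) = stack W l (enc_word (unary k) ++ w) ->
  T (oracle_tape ord0) = stack W 0 [::] ->
  exists T' l', [/\ runs fload T (6 * k + 2) T', T' (reg 0) = stack W l' w,
    T' (oracle_tape ord0) = stack W 0 (unary k) &
    forall i, i != reg 0 -> i != oracle_tape ord0 -> T' i = T i].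
Proof.
have /eqP/negPf neq : oracle_tape ord0 <> reg 0 by apply: oracle_tape_reg; lia.
have neq' : reg 0 == oracle_tape ord0 = false by rewrite eq_sym.
rewrite /fload; set loop := fwhile _ _.
have run_loop j : T (reg 0) = stack W l (enc_word (unary k) ++ w) ->
    T (oracle_tape ord0) = stack W 0 (unary j) ->
  exists T' l', [/\ runs loop T (6 * k + 1) T', T' (reg 0) = stack W l' (false :: w),
    T' (oracle_tape ord0) = stack W 0 (unary (k + j)) &
    forall i, i != reg 0 -> i != oracle_tape ord0 -> T' i = T i].
  elim: k T l j => [|k IH] T l j T0 Tm.
    exists T, l; split=> //; apply: runs_fwhile_end.
    by rewrite ffunE T0.
  have run1 := runs_fpop T0; set T1 := set_tape _ _ _ in run1.
  have T10 : T1 (reg 0) = stack W l.+1 (true :: enc_word (unary k) ++ w).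
    by rewrite set_tapeE.
  have run2 := runs_fpop T10; set T2 := set_tape _ _ _ in run2.
  have T2m : T2 (oracle_tape ord0) = stack W 0 (unary j).
    by rewrite set_tapeN ?neq // set_tapeN ?neq.
  have run3 := runs_fpush true T2m; set T3 := set_tape _ _ _ in run3.
  have T30 : T3 (reg 0) = stack W l.+2 (enc_word (unary k) ++ w).
    by rewrite set_tapeN ?neq' // set_tapeE.
  have [T' [l' [run T'0 T'm T'N]]] := IH T3 l.+2 j.+1 T30 (set_tapeE _ _ _).
  exists T', l'; split=> //.
  - apply: runs_le (runs_fwhile_next _ (runs_fseq run1 (runs_fseq run2 run3)) run).
      by lia.
    by rewrite ffunE T0.
  - by rewrite T'm addnS.
  - move=> i ni0 nim; rewrite T'N // set_tapeN // set_tapeN // set_tapeN //.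
move=> T0 Tm; have [T' [l' [run T'0 T'm T'N]]] := run_loop 0 T0 Tm.
have run' := runs_fpop T'0; set T'' := set_tape _ _ _ in run'.
exists T'', l'.+1; split.
- by apply: runs_le (runs_fseq run run'); lia.
- by rewrite set_tapeE.
- by rewrite set_tapeN ?neq // T'm addn0.
- by move=> i ni0 nim; rewrite set_tapeN // T'N.
Qed.

(** The output tape of [M] need not be a stack, as arbitrary symbols may surround the output; it is
    read in place. The word arrives reversed in register 1, as [encode] expects. *)
Definition funload : fragment 'I_(R + n).+1 W :=
  fwhile (fun h => bit_of (h ord_max) : bool)
    (fseq (fif (fun h => bit_of (h ord_max) == Some true)
             (fpush W (reg 1) true) (fpush W (reg 1) false))
       (on_tape ord_max (fun a => (a, MoveRight)))).

Lemma runs_funload T l v w :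
  T (reg 1) = stack W l v ->
  read_bits (thead (T ord_max) :: tright (T ord_max)) = w ->
  exists T' l', [/\ runs funload T (6 * size w + 1) T',
    T' (reg 1) = stack W l' (rev w ++ v), bit_of (thead (T' ord_max)) = None &
    forall i, i != reg 1 -> i != ord_max -> T' i = T i].
Proof.
have neq : (ord_max == reg 1) = false.
  by apply/eqP; rewrite -oracle_tape_max; apply: oracle_tape_reg.
have neq' : (reg 1 == ord_max) = false by rewrite eq_sym.
elim: w T l v => [|b w IH] T l v T1 Tw.
  have hd : bit_of (thead (T ord_max)) = None.
    by case: (thead _) Tw => // -[].
  by exists T, l; split=> //; apply: runs_fwhile_end; rewrite ffunE hd.
have [hd Tw'] : thead (T ord_max) = Some (inl b) /\
    read_bits (tright (T ord_max)) = w.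
  by case: (thead _) Tw => [[c|a]|] //= [-> ->].
have run1 := runs_fpush b T1; set T2 := set_tape _ _ _ in run1.
have run_if : runs (fif (fun h => bit_of (h ord_max) == Some true)
    (fpush W (reg 1) true) (fpush W (reg 1) false)) T 4 T2.
  by apply: runs_fif; rewrite ffunE hd; case: (b) @T2 run1.
have run2 := runs_on_tape ord_max (fun a => (a, MoveRight)) T2.
set T3 := set_tape _ _ _ in run2.
have T2max : T2 ord_max = T ord_max by rewrite set_tapeN ?neq.
have T31 : T3 (reg 1) = stack W (l - (v != [::])) (b :: v).
  by rewrite set_tapeN ?neq' // set_tapeE.
have [|T' [l' [run T'1 T'max T'N]]] := IH T3 _ _ T31.
  by rewrite set_tapeE T2max /=; case: (tright _) Tw'.
exists T', l'; split=> //.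
- apply: runs_le (runs_fwhile_next _ (runs_fseq run_if run2) run).
    by rewrite /=; lia.
  by rewrite ffunE hd.
- by rewrite T'1 rev_cons cat_rcons.
- by move=> i ni1 nim; rewrite T'N // !set_tapeN.
Qed.

(** The head of the output tape stands on a cell without a bit. After a move to the left this cell
    ends the word, so the single bit copied in front of it is the entire output, whatever else the
    tape contains. *)
Definition fanswer : fragment 'I_(R + n).+1 W :=
  fseq (on_tape ord_max (fun a => (a, MoveLeft)))
    (atom (fun h => [ffun j => (h (if j == ord_max then reg 0 else j), Stay)])).

Lemma runs_fanswer T l b :
  T (reg 0) = stack W l [:: b] -> bit_of (thead (T ord_max)) = None ->
  exists2 T', runs fanswer T 2 T' &
    read_bits (thead (T' ord_max) :: tright (T' ord_max)) = [:: b].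
Proof.
move=> T0 hd.
have neq : (ord_max == reg 0) = false.
  by apply/eqP; rewrite -oracle_tape_max; apply: oracle_tape_reg; lia.
have neq' : (reg 0 == ord_max) = false by rewrite eq_sym.
have run1 := runs_on_tape ord_max (fun a => (a, MoveLeft)) T.
eexists; first exact: runs_fseq run1 (runs_atom _ _).
rewrite !ffunE eqxx neq' T0 /=.
by case: (thead _) hd => [[]|].
Qed.

End Oracle.

(** The machine for [f] is inserted as a fragment between loading its input and unloading its
    output, and its work alphabet becomes that of the whole machine; only [G] is a compiled
    program. *)
Theorem polytime_computable_oracle (X : Type) (A Z : etype) (encX : X -> seq bool)
    (f : nat -> A) (G : A * Z -> bool) (k : X -> nat) (z : X -> Z) :
  polytime_computable (fun k => unary k.+1) (@enc A) f -> ptime G ->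
  (forall x, encX x = enc_word (unary (k x).+1) ++ enc (z x)) ->
  polytime_computable encX (fun b => [:: b]) (fun x => G (f (k x), z x)).
Proof.
move=> [M [p haltM]] [c [K [e run_c]]] encE.
have [ep le_p] := poly_bounded_horner p.
(* [encode] prepends the output of [M], reversed in register 1, to the rest of the input in register
   0, which yields the encoded pair that [c] expects. [K.+2] covers register 1 and the scratch
   registers of [c]. *)
pose prog := Seq (encode 1 0) c; pose R := maxn K.+2 (registers prog).
have R_gt1 : 1 < R by rewrite /R; lia.
have reg0 : reg M R 0 = ord0 by apply: val_inj; rewrite /= regK //; lia.
pose F := fseq (fload M R) (fseq (foracle M R) (fseq (funload M R)
  (fseq (compile (work M) (reg M R) prog) (fanswer M R)))).
(* Bound on the output of [M]: the cells of its input, one more for each step, and the cell under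
   the head. *)
pose L n := n + n.+2 ^ ep + 1.
pose T n := (6 * n + 2) + ((n.+2 ^ ep + 1) + ((6 * L n + 1) +
  (((11 * L n + 4) + (2 * L n + n).+2 ^ e) + 2))).
have [p' le_p'] : exists p' : {poly nat}, forall n, T n <= p'.[n]%R.
  by apply: poly_boundedP; rewrite /T /L; poly_bound.
exists (machine_of_fragment F), p' => x.
set n := size (encX x); set m := (k x).+1; set w := enc (f (k x)).
have size_n : n = 2 * m + size (enc (z x)) + 1.
  by rewrite /n encE size_cat size_enc_word size_nseq; lia.
have le_pm : p.[size (unary m)]%R <= n.+2 ^ ep.
  by apply: leq_trans (le_p _) _; rewrite leq_expl // size_nseq; lia.
have [halt out] := haltM (k x); rewrite -/m -/w in halt out.
pose T0 : {ffun 'I_(R + ntapes M).+1 -> tape (cell (work M))} :=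
  ctapes (init (machine_of_fragment F) (encX x)).
have T0reg r : 0 < r < R -> T0 (reg M R r) = stack (work M) 0 [::].
  move=> /andP[r_gt0 ltr]; rewrite ffunE ifN //.
  by apply/eqP => /(congr1 (@nat_of_ord _)); rewrite regK //=; lia.
have T0oracle i : T0 (oracle_tape R i) = stack (work M) 0 [::].
  rewrite ffunE ifN //; apply/eqP => /(congr1 (@nat_of_ord _)).
  by rewrite oracle_tapeK /=; lia.
have T00 : T0 (reg M R 0) = stack (work M) 0 (enc_word (unary m) ++ enc (z x)).
  by rewrite -encE ffunE reg0 eqxx.
have [T1 [l1 [run1 T10 T1in T1N]]] :=
  @runs_fload M R R_gt1 T0 m 0 (enc (z x)) T00 (T0oracle ord0).
have T1c i : T1 (oracle_tape R i) = ctapes (init M (unary m)) i.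
  rewrite ffunE; case: eqP => [->|/eqP ni]; first by rewrite T1in.
  rewrite T1N ?T0oracle //; first by apply/eqP/oracle_tape_reg; lia.
  by apply: contra ni => /eqP/oracle_tape_inj->.
have [T2 [run2 T2c T2N]] := reaches_foracle T1c halt.
have T1reg r : 0 < r < R -> T1 (reg M R r) = stack (work M) 0 [::].
  move=> /andP[r_gt0 ltr]; rewrite T1N ?T0reg ?r_gt0 //.
    by apply: reg_neq; lia.
  by apply/eqP => /esym; apply: oracle_tape_reg.
have T2out : read_bits (thead (T2 ord_max) :: tright (T2 ord_max)) = w.
  by rewrite -(oracle_tape_max M R) T2c -out.
have T2reg1 : T2 (reg M R 1) = stack (work M) 0 [::] by rewrite T2N ?T1reg.
have [T3 [l3 [run3 T31 T3max T3N]]] := runs_funload R_gt1 T2reg1 T2out.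
have max_reg r : r < R -> reg M R r != ord_max.
  by move=> ltr; apply/eqP => /esym; rewrite -(oracle_tape_max M R); apply: oracle_tape_reg.
pose s := upd (upd (fun=> [::]) 1 (rev w)) 0 (enc (z x)).
have T3s : stores (reg M R) R T3 s.
  move=> r ltr; case: (r =P 0) => [->|/eqP nr0].
    exists l1; rewrite /s updE T3N ?T2N ?T10 ?max_reg //; try lia.
    by apply: reg_neq; lia.
  rewrite /s {1}/upd (negPf nr0); case: (r =P 1) => [->|/eqP nr1].
    by exists l3; rewrite updE T31 cats0.
  exists 0; rewrite /upd (negPf nr1) T3N ?T2N ?T1reg ?max_reg //; try lia.
  by apply: reg_neq; lia.
have run_enc := @exec_encode 1 0 s w (enc (z x)) isT erefl erefl.
set s' := upd _ _ _ in run_enc.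
have run_G : exec c s' ((size (enc (f (k x), z x))).+2 ^ e)
    (upd s' 0 (enc (G (f (k x), z x)))).
  by apply: run_c => // i iK; rewrite /s' /s /upd; case: i iK => [|[|i]].
have [T4 [run4 T4s agr4]] :=
  compileP (@reg_inj M R) (exec_seq run_enc run_G) (leq_maxr _ _) T3s.
have [l4 T40] : exists j, T4 (reg M R 0) = stack (work M) j [:: G (f (k x), z x)].
  by apply: T4s; lia.
have T4max : bit_of (thead (T4 ord_max)) = None.
  by rewrite agr4 // => r /max_reg/eqP neq /esym.
have [T5 run5 out5] := runs_fanswer R_gt1 T40 T4max.
have size_w : size w <= L n.
  have le_out : size (tright (ctapes (init M (unary m)) ord_max)) <= m.
    rewrite ffunE [tright _]/= size_behead; case: ifP => // _.
    by rewrite /= size_map size_nseq leqnSn.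
  have := size_tright_iter (init M (unary m)) p.[size (unary m)]%R ord_max.
  rewrite -out /output; move: (iter _ _ _) => d le_d.
  apply: leq_trans (size_read_bits _) _; rewrite [size (_ :: _)]/= /L.
  by move: le_out le_d le_pm size_n; move: p.[_]%R (_ ^ ep) => *; lia.
have run : runs F T0 p'.[n]%R T5.
  apply: (@runs_le _ _ F _ (T n)); first exact: le_p'.
  apply: runs_fseq; first by apply: runs_le run1; lia.
  apply: runs_fseq; first by apply: reaches_le run2; rewrite addn1 ltnS.
  apply: runs_fseq; first by apply: runs_le run3; rewrite leq_add2r leq_mul2l.
  apply: runs_fseq run5; apply: runs_le run4.
  apply: leq_add; first by rewrite leq_add2r leq_mul2l.
  rewrite leq_expl // !ltnS size_enc_pair /= -/w; lia.
have iterE := machine_of_fragmentP run.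
rewrite /halts_within /init iterE; split=> //.
Qed.

(** * Binary arithmetic *)

Fixpoint bin_val (w : seq bool) : nat := if w is b :: w' then b + 2 * bin_val w' else 0.

(* State: the unread parts of both words, the carry, the sum read so far with its
   last bit first. *)
Definition add_step (q : seq bool * seq bool * (bool * seq bool)) :=
  (behead q.1.1, behead q.1.2,
   ((head false q.1.1 && head false q.1.2) ||
      (q.2.1 && (head false q.1.1 || head false q.1.2)),
    head false q.1.1 (+) head false q.1.2 (+) q.2.1 :: q.2.2)).

Definition bin_add (u v : seq bool) : seq bool :=
  rev ((fun q => q.2.1 :: q.2.2)
    (iter (size u + size v) add_step (u, v, (false, [::])))).

(** The least significant bits come first, so the last difference seen decides and overrides the
    earlier ones. *)
Definition lt_step (q : seq bool * seq bool * bool) :=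
  (behead q.1.1, behead q.1.2,
   if head false q.1.1 (+) head false q.1.2 then head false q.1.2 else q.2).

Definition bin_lt (u v : seq bool) : bool :=
  (iter (size u + size v) lt_step (u, v, false)).2.

Lemma bin_val_rev_cons b w : bin_val (rev (b :: w)) = bin_val (rev w) + b * 2 ^ size w.
Proof.
rewrite rev_cons -size_rev; elim: (rev w) => [|a w' IH] /=; first by case: b.
by rewrite IH expnS; lia.
Qed.

Lemma bin_val_behead w : bin_val w = head false w + 2 * bin_val (behead w).
Proof. by case: w. Qed.

Lemma bin_val_add u v : bin_val (bin_add u v) = bin_val u + bin_val v.
Proof.
(* Invariant: the unread parts and the carry, at weight [2 ^ size out], together with the bits
   already output give the final value. *)
suff addP n c out : size u <= n -> size v <= n ->
    let q := iter n add_step (u, v, (c, out)) in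
    bin_val (rev (q.2.1 :: q.2.2)) =
      bin_val (rev out) + (bin_val u + bin_val v + c) * 2 ^ size out.
  by rewrite /bin_add addP ?leq_addr ?leq_addl //= muln1 addn0.
elim: n u v c out => [|n IH] u v c out lu lv.
  by move: lu lv; rewrite !leqn0 !size_eq0 => /eqP-> /eqP->; rewrite /= bin_val_rev_cons.
rewrite iterSr [add_step _]/add_step /= in IH *.
rewrite IH ?size_behead; try lia.
rewrite bin_val_rev_cons (bin_val_behead u) (bin_val_behead v) /= expnS.
by case: (head false u); case: (head false v); case: c => /=; lia.
Qed.

(** A sum of lengths instead of a maximum is affordable: an accumulated total grows by the length of
    the new summand plus one, which is the growth that [ptime_foldl] admits. *)
Lemma size_bin_add u v : size (bin_add u v) = (size u + size v).+1.
Proof.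
rewrite /bin_add size_rev /=; congr _.+1.
suff szP q n : size (iter n add_step q).2.2 = size q.2.2 + n by rewrite szP.
by elim: n => [|n IH] /=; rewrite ?addn0 // IH addnS.
Qed.

Lemma bin_ltE u v : bin_lt u v = (bin_val u < bin_val v).
Proof.
suff ltP n r : size u <= n -> size v <= n ->
    (iter n lt_step (u, v, r)).2 =
      if bin_val u == bin_val v then r else bin_val u < bin_val v.
  by rewrite /bin_lt ltP ?leq_addr ?leq_addl //; case: ltngtP.
elim: n u v r => [|n IH] u v r lu lv.
  by move: lu lv; rewrite !leqn0 !size_eq0 => /eqP-> /eqP->.
rewrite iterSr [lt_step _]/lt_step /= IH ?size_behead; try lia.
rewrite [X in _ = if X == _ then _ else _]bin_val_behead.
rewrite [X in _ = if _ == X then _ else _]bin_val_behead.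
rewrite [X in _ = if _ then _ else X < _]bin_val_behead.
rewrite [X in _ = if _ then _ else _ < X]bin_val_behead.
case: (head false u); case: (head false v) => /=; do 2!case: eqP => //; lia.
Qed.

Lemma bin_val_bits_of_nat n : bin_val (bits_of_nat n) = n.
Proof.
rewrite /bits_of_nat -[in RHS](bin_of_natK n).
case: (bin_of_nat n) => //= p.
by elim: p => //= p ->; rewrite NatTrec.doubleE; lia.
Qed.

Lemma size_enc_behead (A : etype) (l : seq A) : size (enc (behead l)) <= size (enc l).
Proof. by rewrite -drop1 size_enc_drop. Qed.

Lemma size_enc_bits (w : seq bool) : size (enc w) = 3 * size w.
Proof. by elim: w => // b w IH; rewrite size_enc_cons IH size_enc_bool /=; lia. Qed.

Ltac ptime_more ::= lazymatch goal with
  | |- ptime (fun x => head _ (@?l x)) => apply: ptime_head; ptime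
  | |- ptime (fun x => behead (@?l x)) => apply: (ptime_behead false); ptime
  | |- ptime (fun x => nth _ (@?l x) (@?i x)) => apply: ptime_nth; ptime
  | |- ptime (fun x => size (@?l x)) => apply: ptime_size_seq; ptime
  | |- ptime (fun x => rev (@?l x)) => apply: ptime_rev; ptime
  | |- ptime (fun x => drop (@?n x) (@?l x)) => apply: (ptime_drop 0); ptime
  | |- ptime (fun x => iota 0 (@?n x)) => apply: ptime_iota0; ptime
  | |- ptime (fun x => @?m x + @?n x) => apply: ptime_add; ptime
  | |- ptime (fun x => @?m x - @?n x) => apply: ptime_sub; ptime
  | |- ptime (fun x => @?m x * @?n x) => apply: ptime_mul; ptime
  | |- ptime (fun x => bits_of_word (@?w x)) => apply: ptime_bits; ptime
  end.

Lemma ptime_bin_add (X : etype) (u v : X -> seq bool) :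
  ptime u -> ptime v -> ptime (fun x => bin_add (u x) (v x)).
Proof.
apply: (ptime_comp2 (g := bin_add)); rewrite /bin_add.
pose init (q : seq bool * seq bool) := (q.1, q.2, (false, [::] : seq bool)).
have pi : ptime (fun q => iter (size q.1 + size q.2) add_step (init q)).
  apply: (@ptime_iter _ _ (fun=> add_step)); rewrite /init /add_step; ptime.
  exists 2 => x b; have : 4 <= (size (enc x)).+2 ^ 2 by apply: (@leq_expl 2 2).
  move: (_ ^ 2) => t; rewrite !(size_enc_pair, size_enc_cons) /= ?size_enc_bool.
  by have /= := size_enc_behead b.1.1; have /= := size_enc_behead b.1.2; lia.
apply: ptime_rev.
apply: (ptime_comp _ pi
  (g := fun q : seq bool * seq bool * (bool * seq bool) => q.2.1 :: q.2.2)).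
by ptime.
Qed.

Lemma ptime_bin_lt (X : etype) (u v : X -> seq bool) :
  ptime u -> ptime v -> ptime (fun x => bin_lt (u x) (v x)).
Proof.
apply: (ptime_comp2 (g := bin_lt)); rewrite /bin_lt; apply: ptime_snd.
apply: (@ptime_iter _ _ (fun=> lt_step)); rewrite /lt_step; ptime.
  by apply: ptime_if; ptime.
exists 0 => x b; rewrite !size_enc_pair /= ?size_enc_bool.
have /= := size_enc_behead b.1.1; have /= := size_enc_behead b.1.2; lia.
Qed.

(** * The algorithm *)

Definition entry m (O : word) x y : bool := nth false (bits_of_word O) (x * m + y).

Definition above m O d := count (fun x => entry m O x d) (iota 0 m).
Definition below m O c := count (fun y => entry m O c y) (iota 0 m).
Definition between m O c d :=
  count (fun x => entry m O c x && entry m O x d) (iota 0 m).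

(* Pairs (position of [d], position of [c]), counted from 0. *)
Definition placements m O c d : seq (nat * nat) :=
  if entry m O c d then
    [seq (i + (between m O c d).-1, i)
       | i <- drop (above m O d - between m O c d) (iota 0 (m - below m O c).+1)]
  else [:: ((above m O d).-1, m - below m O c)].

Definition score_at (S : seq word) i := bits_of_word (nth (Word [::]) S i).

(** A pair stands for the points of [d] minus those of [c]. Comparing differences by adding
    crosswise avoids negative numbers. *)
Definition better_gain S (g : seq bool * seq bool) (p : nat * nat) :=
  if bin_lt (bin_add g.1 (score_at S p.2)) (bin_add (score_at S p.1) g.2)
  then (score_at S p.1, score_at S p.2) else g.

Definition best_gain S (ps : seq (nat * nat)) :=
  foldl (better_gain S)
    (score_at S (head (0, 0) ps).1, score_at S (head (0, 0) ps).2) ps.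

Definition add_gains (g h : seq bool * seq bool) := (bin_add g.1 h.1, bin_add g.2 h.2).

Definition total_gain S m Os c d :=
  foldl (fun g O => add_gains g (best_gain S (placements m O c d))) ([::], [::]) Os.

Definition always_beats S m Os c d :=
  bin_lt (total_gain S m Os c d).1 (total_gain S m Os c d).2.

(** The candidate is known by its characteristic vector only. Running over all [c] and accepting
    those outside the vector saves the search for its index; the length of the vector is the number
    of alternatives. *)
Definition decide_necessary_winner (q : seq word * (word * seq word)) : bool :=
  let chi := bits_of_word q.2.1 in
  let m := size chi in
  all (fun c => ~~ nth false chi c ||
    all (fun d => nth false chi d || always_beats q.1 m q.2.2 c d) (iota 0 m))
    (iota 0 m).

Lemma ptime_entry (X : etype) (m : X -> nat) O x y :
  ptime m -> ptime O -> ptime x -> ptime y ->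
  ptime (fun e => entry (m e) (O e) (x e) (y e)).
Proof. by move=> *; rewrite /entry; ptime. Qed.

Lemma ptime_placements :
  ptime (fun q : nat * word * nat * nat => placements q.1.1.1 q.1.1.2 q.1.2 q.2).
Proof.
have pabove : ptime (fun q : nat * word * nat * nat => above q.1.1.1 q.1.1.2 q.2).
  by apply: ptime_count; ptime; apply: ptime_entry; ptime.
have pbelow : ptime (fun q : nat * word * nat * nat => below q.1.1.1 q.1.1.2 q.1.2).
  by apply: ptime_count; ptime; apply: ptime_entry; ptime.
have pbetween :
    ptime (fun q : nat * word * nat * nat => between q.1.1.1 q.1.1.2 q.1.2 q.2).
  by apply: ptime_count; ptime; apply: ptime_entry; ptime.
apply: ptime_if; first by apply: ptime_entry; ptime.
  apply: ptime_map; ptime.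
  by apply: ptime_comp pbetween _; ptime.
by ptime.
Qed.

Lemma ptime_score_at (X : etype) (S : X -> seq word) i :
  ptime S -> ptime i -> ptime (fun x => score_at (S x) (i x)).
Proof. by move=> *; rewrite /score_at; ptime. Qed.

Lemma ptime_best_gain (X : etype) (S : X -> seq word) ps :
  ptime S -> ptime ps -> ptime (fun x => best_gain (S x) (ps x)).
Proof.
apply: (ptime_comp2 (g := best_gain)); rewrite /best_gain.
have pgain : ptime (fun r : seq word * seq (nat * nat) * (nat * nat) =>
    (score_at r.1.1 r.2.1, score_at r.1.1 r.2.2)).
  by ptime; apply: ptime_score_at; ptime.
apply: (@ptime_foldl _ _ _ (fun q => better_gain q.1)).
- by apply: ptime_if; ptime; repeat first
    [ apply: ptime_bin_lt | apply: ptime_bin_add | apply: ptime_score_at ]; ptime.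
- have [k size_gain] := ptime_size pgain; exists k => q g p.
  have /= := size_gain (q, p); rewrite /better_gain.
  by case: ifP => _; lia.
- by ptime; apply: ptime_score_at; ptime.
- by ptime.
Qed.

Lemma ptime_total_gain :
  ptime (fun q : seq word * (nat * (seq word * (nat * nat))) =>
    total_gain q.1 q.2.1 q.2.2.1 q.2.2.2.1 q.2.2.2.2).
Proof.
have pbest : ptime (fun r : seq word * (nat * (seq word * (nat * nat))) * word =>
    best_gain r.1.1 (placements r.1.2.1 r.2 r.1.2.2.2.1 r.1.2.2.2.2)).
  apply: ptime_best_gain; ptime.
  apply: (ptime_comp ptime_placements (f := fun r : _ * _ =>
    (r.1.2.1, r.2, r.1.2.2.2.1, r.1.2.2.2.2))).
  by ptime.
rewrite /total_gain.
apply: (@ptime_foldl _ _ _ (fun q (g : seq bool * seq bool) O =>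
  add_gains g (best_gain q.1 (placements q.2.1 O q.2.2.2.1 q.2.2.2.2)))); ptime.
- apply: (ptime_comp2 (g := add_gains) (f := fun r : _ * _ * word => r.1.2)
    (f' := fun r => best_gain r.1.1.1
                      (placements r.1.1.2.1 r.2 r.1.1.2.2.2.1 r.1.1.2.2.2.2))).
  + by rewrite /add_gains; ptime; apply: ptime_bin_add; ptime.
  + by ptime.
  + by apply: (ptime_comp pbest (f := fun r : _ * _ * word => (r.1.1, r.2))); ptime.
- have [k size_best] := ptime_size pbest.
  (* Each addition costs one extra bit, of encoded size 3; this is doubled in the first component of
     the pair, hence 6 + 3. *)
  have [q le_q] : poly_bounded (fun n => n.+2 ^ k + 9) by poly_bound.
  exists q => e g O; have := le_q (size (enc (e, O))).
  have /= := size_best (e, O); move: (best_gain _ _) => h.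
  rewrite !size_enc_pair /= !size_enc_bits !size_bin_add; lia.
Qed.

Lemma ptime_decide_necessary_winner : ptime decide_necessary_winner.
Proof.
apply: ptime_all; last by ptime.
apply: ptime_orb; first by ptime.
apply: ptime_all; last by ptime.
apply: ptime_orb; first by ptime.
have ptotal : ptime (fun r : seq word * (word * seq word) * nat * nat =>
    total_gain r.1.1.1 (size (bits_of_word r.1.1.2.1)) r.1.1.2.2 r.1.2 r.2).
  apply: (ptime_comp ptime_total_gain (f := fun r : _ * (word * _) * nat * nat =>
    (r.1.1.1, (size (bits_of_word r.1.1.2.1), (r.1.1.2.2, (r.1.2, r.2)))))).
  by ptime.
by apply: ptime_bin_lt; ptime.
Qed.

(** * Positions of two alternatives in linear extensions *)

Section LinearExtensions.
Variables (C : finType) (O : partial_order C).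

Definition upset (x : C) := [set y | O y x].
Definition downset (x : C) := [set y | O x y].

Lemma mem_upset x y : (y \in upset x) = O y x. Proof. by rewrite inE. Qed.

(** Sorting by the size of the upset therefore respects [O], which replaces a topological sort. *)
Lemma card_upset_lt x y : O x y -> x != y -> #|upset x| < #|upset y|.
Proof.
move=> Oxy neq; apply: proper_card; apply/properP; split.
  by apply/subsetP => z; rewrite !mem_upset => Ozx; apply: po_trans Ozx Oxy.
exists y; rewrite mem_upset ?po_refl //; apply: contra neq => Oyx.
by apply/eqP/(@po_anti _ O); rewrite Oxy.
Qed.

Lemma order_of_key (key : C -> nat) : injective key ->
  exists V : linear_order C, forall x y, V x y = (key x <= key y).
Proof.
move=> key_inj; pose r : rel C := fun x y => key x <= key y.
have r_anti : antisymmetric r by move=> x y; rewrite /r -eqn_leq => /eqP/key_inj.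
have r_trans : transitive r by move=> y x z; apply: leq_trans.
by exists (@LinearOrder C (@PartialOrder C r (fun x => leqnn (key x)) r_anti r_trans)
          (fun x y => leq_total (key x) (key y))).
Qed.

(** Fixes the positions of chosen alternatives by giving each a level of its own, while the order
    inside the other levels may remain unspecified. *)
Lemma linear_extension_level (lev : C -> nat) :
  (forall x y, O x y -> lev x <= lev y) ->
  exists2 V : linear_order C, subrel O V &
    forall x, (forall y, lev y = lev x -> y = x) ->
      position V x = #|[set y | lev y <= lev x]|.
Proof.
move=> lev_mono; set m := #|C|.
(* A lexicographic key packed into one number: the level, then the size of the upset to respect [O]
   within a level, then [enum_rank] for injectivity. *)
pose rank x := lev x * m.+1 + #|upset x|.
pose key x := rank x * m + enum_rank x.
have key_lt x y : rank x < rank y -> key x < key y.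
  move=> lt_xy; have := ltn_ord (enum_rank x); rewrite -/m /key => lt_m.
  have le_rank : (rank x).+1 * m <= rank y * m by rewrite leq_mul2r lt_xy orbT.
  apply: leq_trans (leq_addr _ _); apply: leq_trans le_rank.
  by rewrite mulSn addnC ltn_add2r.
have key_inj : injective key.
  move=> x y eq_key; case: (ltngtP (rank x) (rank y)) => [/key_lt|/key_lt|eq_rank].
  - by rewrite eq_key ltnn.
  - by rewrite eq_key ltnn.
  by apply/enum_rank_inj/val_inj; move: eq_key; rewrite /key eq_rank => /addnI.
have lev_lt x y : lev x < lev y -> key x < key y.
  move=> lt_xy; apply: key_lt; have := max_card (upset x); rewrite -/m /rank.
  have : (lev x).+1 * m.+1 <= lev y * m.+1 by rewrite leq_mul2r lt_xy orbT.
  by rewrite [X in X <= _]mulSn; lia.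
have [V VE] := order_of_key key_inj; exists V => [x y Oxy | x lev_x].
  rewrite VE; case: (x =P y) => [-> // | /eqP neq]; apply/ltnW/key_lt.
  rewrite /rank -addnS; apply: leq_add (card_upset_lt Oxy neq).
  by rewrite leq_mul2r lev_mono ?orbT.
apply: eq_card => y; rewrite !inE VE.
apply/idP/idP => [|le_lev].
  by rewrite leqNgt [_ <= lev _]leqNgt; apply: contra => /lev_lt.
have [/lev_lt/ltnW // | ge_lev] := ltnP (lev y) (lev x).
by rewrite (lev_x y) //; apply/eqP; rewrite eqn_leq le_lev.
Qed.

Definition up_closed (U : {set C}) := forall x y, O y x -> x \in U -> y \in U.

(** A discrete intermediate value argument: [A] is enlarged inside [B] by one alternative at a
    time. *)
Lemma up_closed_between (A B : {set C}) k :
  up_closed A -> up_closed B -> A \subset B -> #|A| <= k <= #|B| ->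
  exists U, [/\ up_closed U, A \subset U, U \subset B & #|U| = k].
Proof.
move=> upA upB sAB; move def_n: (k - #|A|) => n.
elim: n A upA sAB def_n => [|n IH] A upA sAB def_n /andP[leA leB].
  by exists A; split=> //; lia.
have /subsetPn[x0 x0B x0A] : ~~ (B \subset A).
  by apply/negP => /subset_leq_card; lia.
have x0BA : x0 \in B :\: A by rewrite inE x0A.
(* An element of [B :\: A] with the smallest upset has everything strictly above it already in [A],
   so adding it keeps the set up-closed. *)
case: (@arg_minnP _ x0 [in B :\: A] (fun x => #|upset x|) x0BA) => x /setDP[xB xA] min_x.
have [|||| U [upU sAU sUB cardU]] := IH (x |: A).
- move=> z y Oyz; rewrite !inE => /orP[/eqP eq_z | zA]; last first.
    by rewrite (upA z y) ?orbT.
  rewrite eq_z in Oyz; case: eqP => //= /eqP neq; apply/negPn/negP => yA.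
  have := card_upset_lt Oyz neq; rewrite ltnNge min_x //.
  by rewrite inE yA (upB x y).
- by rewrite subUset sub1set xB.
- by rewrite cardsU1 xA; lia.
- by rewrite cardsU1 xA; lia.
exists U; split=> //; apply: subset_trans sAU; exact: subsetUr.
Qed.

(* If [c] is above [d], the alternatives between them can be placed in one block
   from [c] to [d], which slides over the places left by the other ones. *)
Definition position_pairs (c d : C) : seq (nat * nat) :=
  let b := #|downset c :&: upset d| in
  if O c d then
    [seq (i + b.-1, i) | i <- drop (#|upset d| - b) (iota 0 (#|C| - #|downset c|).+1)]
  else [:: (#|upset d|.-1, #|C| - #|downset c|)].

Variables c d : C.
Hypothesis neq_cd : d != c.

Let anti x y : O x y -> O y x -> x = y.
Proof. by move=> Oxy Oyx; apply: (@po_anti _ O); rewrite Oxy. Qed.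

Lemma position_pairs_realized p : p \in position_pairs c d ->
  exists2 V : linear_order C, subrel O V &
    (position V d).-1 = p.1 /\ (position V c).-1 = p.2.
Proof.
have tr := @po_trans _ O; have rf := @po_refl _ O.
rewrite /position_pairs; case: ifP => Ocd.
  case/mapP => i; rewrite drop_iota mem_iota add0n => /andP[le_i lt_i] -> /=.
  set b := #|_ :&: _| in le_i lt_i *.
  have def_b : #|upset d :&: downset c| = b by rewrite setIC.
  have leA : #|upset d :\: downset c| <= i by rewrite cardsD def_b.
  have leB : i <= #|~: downset c| by have := cardsC (downset c); lia.
  (* The [i] alternatives above the block form an up-closed set. It has to contain whatever is above
     [d] outside the block, and to avoid [c] and everything below [c]. *)
  have [||||U [upU sAU sUB cardU]] :=
    @up_closed_between (upset d :\: downset c) (~: downset c) i.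
  - move=> x y Oyx; rewrite !inE => /andP[Ncx Oxd]; rewrite (tr x y d) // andbT.
    by apply: contra Ncx => Ocy; apply: tr Ocy Oyx.
  - by move=> x y Oyx; rewrite !inE; apply: contra => Ocy; apply: tr Ocy Oyx.
  - by apply/subsetP => x; rewrite !inE => /andP[].
  - by rewrite leA.
  have UNc x : x \in U -> ~~ O c x by move=> /(subsetP sUB); rewrite !inE.
  have inU x : O x d -> x \notin U -> O c x.
    move=> Oxd; apply: contraNT => Ncx; apply: (subsetP sAU).
    by rewrite !inE Ncx.
  (* Level 2 is exactly what lies strictly between [c] and [d]: an alternative above [d] and outside
     [U] is below [c] by [inU]. *)
  pose lev x := if x \in U then 0 else if x == c then 1 else if x == d then 3
                else if O x d then 2 else 4.
  have cU : c \notin U by apply/negP => /UNc; rewrite rf.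
  have dU : d \notin U by apply/negP => /UNc; rewrite Ocd.
  have lev_c : lev c = 1 by rewrite /lev (negPf cU) eqxx.
  have lev_d : lev d = 3 by rewrite /lev (negPf dU) (negPf neq_cd) eqxx.
  have [x y Oxy | V sOV posV] := @linear_extension_level lev.
    rewrite /lev; case: (boolP (y \in U)) => yU; first by rewrite (upU y x).
    case: (boolP (x \in U)) => xU //; case: (x =P c) => [_|neq_xc].
      by do !case: ifP.
    case: (y =P c) => [eq_yc|_].
      have := inU x (tr _ _ _ Oxy _) xU; rewrite eq_yc in Oxy *.
      by move=> /(_ Ocd) /anti-/(_ Oxy) eq_cx; case: neq_xc.
    case: (y =P d) => [eq_yd|neq_yd].
      by rewrite -eq_yd Oxy; case: ifP.
    case: (boolP (O y d)) => [Oyd|_]; last by do !case: ifP.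
    case: (x =P d) => [eq_xd|_]; last by rewrite (tr y).
    by rewrite eq_xd in Oxy; case: neq_yd; apply: anti.
  exists V => //; rewrite !posV; first 1 last.
  - move=> x; rewrite lev_c /lev; case: ifP => // _; case: (x =P c) => // _.
    by do !case: ifP.
  - move=> x; rewrite lev_d /lev; case: ifP => // _; case: (x =P c) => // _.
    by case: (x =P d) => // _; case: ifP.
  rewrite lev_c lev_d; split.
    rewrite (_ : [set _ | _] = U :|: (downset c :&: upset d)).
      rewrite cardsU cardU (_ : U :&: _ = set0) ?cards0 -/b.
        have : 0 < b by apply/card_gt0P; exists c; rewrite !inE rf.
        by lia.
      by apply/setP => x; rewrite !inE; case: (boolP (x \in U)) => // /UNc/negPf->.
    apply/setP => x; rewrite !inE /lev; case: (boolP (x \in U)) => // xU /=.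
    case: (x =P c) => [->|_]; first by rewrite rf Ocd.
    case: (x =P d) => [->|_]; first by rewrite rf Ocd.
    by case: (boolP (O x d)) => [Oxd|_]; rewrite ?andbF // (inU x).
  rewrite (_ : [set _ | _] = c |: U); first by rewrite cardsU1 cU cardU.
  apply/setP => x; rewrite !inE /lev; case: (boolP (x \in U)) => xU; rewrite ?orbT //.
  by case: eqP => // _; case: eqP => // _; case: ifP.
rewrite inE => /eqP-> /=.
(* From the top: what is strictly above [d], then [d], the other alternatives, [c], what is strictly
   below [c]. The upset of [d] and the downset of [c] are disjoint because [c] is not above [d]. *)
pose lev x := if O x d then (x == d : nat) else
              if O c x then (if x == c then 3 else 4) else 2.
have lev_c : lev c = 3 by rewrite /lev Ocd rf eqxx.
have lev_d : lev d = 1 by rewrite /lev rf eqxx.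
have [x y Oxy | V sOV posV] := @linear_extension_level lev.
  rewrite /lev; case: (boolP (O y d)) => Oyd.
    rewrite (tr y) //; case: (x =P d) => // eq_xd; rewrite eq_xd in Oxy.
    by rewrite (anti Oyd Oxy) eqxx.
  case: (boolP (O x d)) => Oxd; first by case: (x == d); do !case: ifP.
  case: (boolP (O c x)) => Ocx; last by do !case: ifP.
  rewrite (tr x) //; case: (y =P c) => [eq_yc|_]; last by case: ifP.
  by rewrite eq_yc in Oxy; rewrite (anti Ocx Oxy) eqxx.
exists V => //; rewrite !posV; first 1 last.
- move=> x; rewrite lev_c /lev; case: ifP => _; first by case: eqP.
  by case: ifP => // _; case: eqP.
- move=> x; rewrite lev_d /lev; case: ifP => _; first by case: eqP.
  by case: ifP => // _; case: eqP.
rewrite lev_c lev_d; split.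
  congr _.-1; apply: eq_card => x; rewrite !inE /lev; case: ifP => _.
    by case: eqP.
  by case: ifP => // _; case: eqP.
rewrite (_ : [set _ | _] = ~: (downset c :\ c)).
  have := cardsC (downset c :\ c); have := cardsD1 c (downset c).
  by have := max_card (downset c); rewrite inE rf /=; lia.
apply/setP => x; rewrite !inE /lev; case: (boolP (O x d)) => Oxd.
  case: (x =P c) Oxd => [->|_ Oxd] /=; first by rewrite Ocd.
  case: (boolP (O c x)) => [Ocx|_]; last by case: eqP.
  by rewrite (tr x c d) in Ocd.
by case: (x =P c) => [->|_] /=; rewrite ?rf //; case: ifP.
Qed.

(** Since scores do not increase downwards, a listed pair with [d] no lower and [c] no higher than
    in [V] yields at least the difference obtained in [V]. *)
Lemma position_pairs_dominate (V : linear_order C) : subrel O V ->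
  exists p, [/\ p \in position_pairs c d, p.1 <= (position V d).-1 &
                (position V c).-1 <= p.2].
Proof.
move=> sOV; rewrite /position_pairs.
have Vtr := @po_trans _ V; have Vrf := @po_refl _ V.
have Vanti x y : V x y -> V y x -> x = y.
  by move=> Vxy Vyx; apply: (@po_anti _ V); rewrite Vxy.
have le_up : #|upset d| <= position V d.
  by apply: subset_leq_card; apply/subsetP => x; rewrite !inE => /sOV.
have c_in : c \in downset c by rewrite inE po_refl.
have le_down : position V c <= (#|C| - #|downset c|).+1.
  have sub : [set y | V y c] \subset c |: ~: downset c.
    apply/subsetP => x; rewrite !inE => Vxc; case: eqP => //= neq.
    by apply/negP => /sOV Vcx; apply: neq; apply: Vanti.
  have := subset_leq_card sub; rewrite cardsU1 inE c_in /=.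
  by rewrite -(cardsC (downset c)) addKn add1n.
case: ifP => Ocd; last first.
  exists (#|upset d|.-1, #|C| - #|downset c|).
  split=> /=; [exact: mem_head | by rewrite -!subn1 leq_sub2r |].
  by case: (position V c) le_down.
set b := #|_ :&: _|; set i := (position V c).-1.
have pos_c : 0 < position V c by apply/card_gt0P; exists c; rewrite inE.
(* In [V], the [i] alternatives strictly above [c] are disjoint from the [b] ones between [c] and
   [d], and all of them are at or above [d]. *)
have le_b : i + b <= position V d.
  have sub : ([set y | V y c] :\ c) :|: (downset c :&: upset d) \subset [set y | V y d].
    apply/subsetP => x; rewrite !inE => /orP[/andP[_ Vxc]|/andP[_ /sOV//]].
    by apply: Vtr Vxc (sOV _ _ Ocd).
  apply: leq_trans (subset_leq_card sub); rewrite cardsU.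
  rewrite (_ : ([set y | V y c] :\ c) :&: _ = set0) ?cards0.
    by rewrite subn0 leq_add2r /i /position (cardsD1 c) inE Vrf.
  apply/setP => x; rewrite !inE; apply/negP => /andP[/andP[/eqP neq Vxc] /andP[/sOV Vcx _]].
  by apply: neq; apply: Vanti.
have le_b_up : b <= #|upset d| by apply: subset_leq_card; apply: subsetIr.
have b_gt0 : 0 < b by apply/card_gt0P; exists c; rewrite !inE po_refl.
(* If [c] stands too high for the block to begin there, the block starts at its first admissible
   place, which puts [d] as high as its upset allows. Otherwise [c] keeps its place, and by [le_b]
   the block ends no later than [d] stands in [V]. *)
pose j := maxn i (#|upset d| - b).
have le_j : #|upset d| - b <= #|C| - #|downset c|.
  rewrite -(cardsC (downset c)) addKn /b setIC -cardsD setDE.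
  exact/subset_leq_card/subsetIr.
have le_i : i <= #|C| - #|downset c| by rewrite /i; case: (position V c) le_down.
exists (j + b.-1, j); split.
- apply/mapP; exists j => //; rewrite drop_iota mem_iota add0n leq_maxr /=.
  by rewrite subnKC ?ltnS ?geq_max ?le_i ?le_j // leqW.
- by move: le_b le_b_up b_gt0 le_up; rewrite /j /=; move: (position V d) => pd; lia.
- exact: leq_maxl.
Qed.

End LinearExtensions.

(** * Correctness of the algorithm *)

Lemma nth_allpairs (A B : eqType) (D : Type) (d : D) (f : A -> B -> D) s t x y :
  x \in s -> y \in t ->
  nth d [seq f a b | a <- s, b <- t] (index x s * size t + index y t) = f x y.
Proof.
move=> + yt; have lt_y : index y t < size t by rewrite index_mem.
elim: s => //= a s IH; rewrite inE nth_cat size_map [a == x]eq_sym.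
case: (x =P a) => [-> _ | _ /= xs]; first by rewrite lt_y (nth_map y) ?nth_index.
by rewrite mulSn -addnA ltnNge leq_addr /= addKn IH.
Qed.

Section EnumIndices.
Variable C : finType.
Notation ix := (fun x : C => index x (enum C)).

Lemma iota_enum : iota 0 #|C| = [seq ix x | x <- enum C].
Proof.
apply: (@eq_from_nth _ 0); first by rewrite size_iota size_map cardE.
move=> i; rewrite size_iota => lt_i; rewrite nth_iota // add0n.
have lt_i' : i < size (enum C) by rewrite -cardE.
have x0 : C by case: (enum C) lt_i' => // x0.
by rewrite (nth_map x0) // index_uniq ?enum_uniq.
Qed.

Lemma count_iota (P : pred C) (Q : pred nat) :
  (forall x, Q (ix x) = P x) -> count Q (iota 0 #|C|) = #|[set x | P x]|.
Proof.
move=> eqPQ; rewrite iota_enum count_map (eq_count (a2 := P)) //.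
rewrite -size_filter [RHS]cardE [in RHS]/enum_mem -enumT; congr size.
by apply: eq_filter => x /=; rewrite inE.
Qed.

Lemma all_iota (Q : pred nat) : reflect (forall x, Q (ix x)) (all Q (iota 0 #|C|)).
Proof.
rewrite iota_enum all_map; apply: (iffP allP) => [Qx x | Qx x _]; last exact: Qx.
by apply: (Qx x); rewrite mem_enum.
Qed.

Lemma entry_enc (O : partial_order C) x y :
  entry #|C| (Word (enc_partial_order O)) (ix x) (ix y) = O x y.
Proof.
by rewrite /entry /= cardE nth_allpairs ?mem_enum.
Qed.

Lemma placements_enc (O : partial_order C) c d :
  placements #|C| (Word (enc_partial_order O)) (ix c) (ix d) = position_pairs O c d.
Proof.
rewrite /placements /position_pairs entry_enc.
have -> : above #|C| (Word (enc_partial_order O)) (ix d) = #|upset O d|.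
  by apply: count_iota => x; rewrite entry_enc.
have -> : below #|C| (Word (enc_partial_order O)) (ix c) = #|downset O c|.
  by apply: count_iota => x; rewrite entry_enc.
have -> : between #|C| (Word (enc_partial_order O)) (ix c) (ix d)
    = #|downset O c :&: upset O d|.
  rewrite /between (count_iota (P := fun x => O c x && O x d)) => [|x].
    by apply: eq_card => x; rewrite !inE.
  by rewrite !entry_enc.
by [].
Qed.

End EnumIndices.

Definition score_val S i := bin_val (score_at S i).

(** The middle inequality carries the induction: the gain never decreases along the fold, so the
    result still dominates the pairs met earlier. *)
Lemma foldl_better_gain S g ps :
  let r := foldl (better_gain S) g ps in
  [/\ r = g \/ exists2 p, p \in ps & r = (score_at S p.1, score_at S p.2),
      bin_val g.1 + bin_val r.2 <= bin_val r.1 + bin_val g.2 &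
      forall p, p \in ps ->
        score_val S p.1 + bin_val r.2 <= bin_val r.1 + score_val S p.2].
Proof.
elim: ps g => [|p ps IH] g /=; first by split=> //; left.
have /= [r_eq r_ge r_max] := IH (better_gain S g p).
set r := foldl _ _ _ in r_eq r_ge r_max *.
have step : bin_val g.1 + bin_val (better_gain S g p).2
      <= bin_val (better_gain S g p).1 + bin_val g.2 /\
    score_val S p.1 + bin_val (better_gain S g p).2
      <= bin_val (better_gain S g p).1 + score_val S p.2.
  rewrite /better_gain /score_val bin_ltE !bin_val_add.
  by case: ltnP => /= ?; split; lia.
split.
- case: r_eq => [r_eq | [q q_ps r_eq]]; last first.
    by right; exists q; rewrite // inE q_ps orbT.
  rewrite r_eq /better_gain; case: ifP => _; last by left.
  by right; exists p; rewrite ?mem_head.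
- by case: step; lia.
- move=> q; rewrite inE => /orP[/eqP-> | /r_max //].
  by case: step; lia.
Qed.

Lemma best_gainP S ps : ps != [::] ->
  exists p, [/\ p \in ps,
    best_gain S ps = (score_at S p.1, score_at S p.2) &
    forall q, q \in ps ->
      score_val S q.1 + score_val S p.2 <= score_val S p.1 + score_val S q.2].
Proof.
case: ps => // p0 ps _.
have /= [r_eq _ r_max] := foldl_better_gain S (score_at S p0.1, score_at S p0.2) (p0 :: ps).
have [p p_ps r_p] : exists2 p, p \in p0 :: ps &
    best_gain S (p0 :: ps) = (score_at S p.1, score_at S p.2).
  by case: r_eq => //; exists p0; rewrite ?mem_head.
exists p; split=> // q q_ps.
have : score_val S q.1 + bin_val (best_gain S (p0 :: ps)).2
       <= bin_val (best_gain S (p0 :: ps)).1 + score_val S q.2 := r_max q q_ps.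
by rewrite r_p.
Qed.

Lemma bin_val_total_gain S m Os c d :
  let best O := best_gain S (placements m O c d) in
  bin_val (total_gain S m Os c d).1 = \sum_(O <- Os) bin_val (best O).1 /\
  bin_val (total_gain S m Os c d).2 = \sum_(O <- Os) bin_val (best O).2.
Proof.
move=> best; rewrite /total_gain.
suff sumP g : let r := foldl (fun g O => add_gains g (best O)) g Os in
  bin_val r.1 = bin_val g.1 + \sum_(O <- Os) bin_val (best O).1 /\
  bin_val r.2 = bin_val g.2 + \sum_(O <- Os) bin_val (best O).2.
  by have /= [-> ->] := sumP ([::], [::]).
elim: Os g => [|O Os IH] g /=; first by rewrite !big_nil !addn0.
have /= [-> ->] := IH (add_gains g (best O)).
by rewrite !big_cons !bin_val_add !addnA.
Qed.

(** Some linear extension exists, as the constant level function shows, and the pair dominating it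
    is a member. *)
Lemma position_pairs_neq0 (C : finType) (O : partial_order C) c d :
  d != c -> position_pairs O c d != [::].
Proof.
move=> neq.
have [V sOV _] := @linear_extension_level _ O (fun=> 0) (fun x y _ => leqnn 0).
have [p [p_in _ _]] := position_pairs_dominate neq sOV.
by case: position_pairs p_in.
Qed.

Definition enc_scores (s : seq nat) : seq word := [seq Word (bits_of_nat i) | i <- s].

Lemma score_val_enc s i : score_val (enc_scores s) i = nth 0 s i.
Proof.
rewrite /score_val /score_at /enc_scores; have [lt_i | ge_i] := ltnP i (size s).
  by rewrite (nth_map 0) //= bin_val_bits_of_nat.
by rewrite !nth_default ?size_map.
Qed.

(** The default 0 continues a non-increasing sequence of natural numbers, so the indices need not be
    bounded. *)
Lemma sorted_geq_nth s i j : sorted geq s -> i <= j -> nth 0 s j <= nth 0 s i.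
Proof.
move=> srt le_ij; have [lt_j | ge_j] := ltnP j (size s); last by rewrite nth_default.
have geq_trans : transitive geq by move=> y x z /= le_yx le_zy; apply: leq_trans le_yx.
apply: (sorted_leq_nth geq_trans (fun x => leqnn x) 0 srt) => //.
by rewrite inE (leq_ltn_trans le_ij).
Qed.

Definition enc_votes (C : finType) n (O : poset_profile C n) : seq word :=
  [seq Word (enc_partial_order Q) | Q <- O].

Lemma always_beatsP (s : scoring_vectors) (C : finType) n (O : poset_profile C n)
    (c d : C) : sorted geq (s #|C|) -> d != c ->
  always_beats (enc_scores (s #|C|)) #|C| (enc_votes O)
    (index c (enum C)) (index d (enum C)) <->
  (forall P : profile C n, extends P O -> score s P d < score s P c).
Proof.
move=> srt neq; set S := enc_scores _.
pose sc i := nth 0 (s #|C|) i.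
have scoreE (P : profile C n) x :
    score s P x = \sum_(i < n) sc (position (tnth P i) x).-1.
  by rewrite /score big_tuple.
have best i : exists p, [/\ p \in position_pairs (tnth O i) c d,
    best_gain S (position_pairs (tnth O i) c d) = (score_at S p.1, score_at S p.2) &
    forall q, q \in position_pairs (tnth O i) c d -> sc q.1 + sc p.2 <= sc p.1 + sc q.2].
  have [p [p_in p_best p_max]] := best_gainP S (position_pairs_neq0 (tnth O i) neq).
  by exists p; split=> // q /p_max; rewrite !score_val_enc.
have [p pP] := fin_all_exists best.
have beatsE : always_beats S #|C| (enc_votes O) (index c (enum C)) (index d (enum C))
    = (\sum_(i < n) sc (p i).1 < \sum_(i < n) sc (p i).2).
  rewrite /always_beats bin_ltE.
  have /= [-> ->] := bin_val_total_gain S #|C| (enc_votes O)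
    (index c (enum C)) (index d (enum C)).
  rewrite !big_map !big_tuple; congr (_ < _); apply: eq_bigr => i _;
    by rewrite placements_enc; have [_ -> _] := pP i; apply: score_val_enc.
rewrite beatsE; split=> [lt_p P PO | beats].
  (* Any completion of vote [i] is dominated by a listed pair, and [p i] is the best of these;
     summing over the votes gives the claim. *)
  have le_i i : sc (position (tnth P i) d).-1 + sc (p i).2
      <= sc (p i).1 + sc (position (tnth P i) c).-1.
    have [q [q_in q1 q2]] := position_pairs_dominate neq (PO i).
    have [_ _ /(_ q q_in)] := pP i.
    have := sorted_geq_nth srt q1; have := sorted_geq_nth srt q2; rewrite -!/(sc _).
    lia.
  have : \sum_(i < n) (sc (position (tnth P i) d).-1 + sc (p i).2)
      <= \sum_(i < n) (sc (p i).1 + sc (position (tnth P i) c).-1).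
    by apply: leq_sum => i _.
  rewrite !big_split /= !scoreE => le_sum.
  rewrite -(ltn_add2r (\sum_(i < n) sc (p i).2)); apply: leq_ltn_trans le_sum _.
  by rewrite addnC ltn_add2l.
(* Each optimum is attained by a completion of its own vote, so a single profile attains all of them
   simultaneously and the test is also necessary. *)
have real i : exists V : linear_order C, subrel (tnth O i) V /\
    ((position V d).-1 = (p i).1 /\ (position V c).-1 = (p i).2).
  have [p_in _ _] := pP i.
  by have [V sOV posV] := position_pairs_realized neq p_in; exists V.
have [V VP] := fin_all_exists real.
have PO : extends [tuple V i | i < n] O.
  by move=> i; rewrite tnth_mktuple; case: (VP i).
have := beats _ PO; rewrite !scoreE.
congr (_ < _); apply: eq_bigr => i _; rewrite tnth_mktuple;
  by have [_ [pos_d pos_c]] := VP i; rewrite ?pos_d ?pos_c.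
Qed.

Lemma scoring_winners_eq1 (s : scoring_vectors) (C : finType) n (P : profile C n) c :
  scoring_winners s P = [set c] <-> (forall d, d != c -> score s P d < score s P c).
Proof.
split=> [winE d neq | beats].
  have : c \in scoring_winners s P by rewrite winE set11.
  rewrite inE => /forallP c_max; rewrite ltnNge; apply: contra neq => le_cd.
  rewrite -in_set1 -winE inE; apply/forallP => y.
  exact: leq_trans (c_max y) le_cd.
apply/setP => x; rewrite !inE; apply/forallP/eqP => [x_max | -> y].
  by apply/eqP/negPn/negP => /beats; rewrite ltnNge x_max.
by case: (y =P c) => [-> // | /eqP/beats/ltnW].
Qed.

Definition enc_votes_instance (I : nw_instance) : word * seq word :=
  (Word [seq x == candidate I | x <- enum (alternatives I)],
   enc_votes (partial_votes I)).

Lemma decide_necessary_winnerP (s : scoring_vectors) (I : nw_instance) :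
  sorted geq (s #|alternatives I|) ->
  decide_necessary_winner (enc_scores (s #|alternatives I|), enc_votes_instance I)
  <-> necessary_winner (scoring_rule s) (partial_votes I) (candidate I).
Proof.
case: I => C c n O /= srt; rewrite /decide_necessary_winner /= size_map -cardE.
have chiE x : nth false [seq y == c | y <- enum C] (index x (enum C)) = (x == c).
  by rewrite (nth_map x) ?index_mem ?mem_enum // nth_index ?mem_enum.
(* The only winner is the one with a strictly larger score than each rival; the quantifiers over
   rivals and extensions commute, so the rivals are treated separately. *)
have -> : necessary_winner (scoring_rule s) O c <->
    forall d, d != c -> forall P, extends P O -> score s P d < score s P c.
  split=> [nw d neq P PO | beats P PO]; first exact/(scoring_winners_eq1 s P c).1/neq/nw.
  by apply/scoring_winners_eq1 => d neq; apply: beats.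
split=> [/(@all_iota C) main d neq | beats].
  have := main c; rewrite chiE eqxx => /(@all_iota C)/(_ d).
  by rewrite chiE (negPf neq) => /(always_beatsP _ srt neq).
apply/(@all_iota C) => x; rewrite chiE; case: (x =P c) => [->|] //=.
apply/(@all_iota C) => d; rewrite chiE; case: (boolP (d == c)) => //= neq.
exact/(always_beatsP _ srt neq)/beats.
Qed.

Theorem proposition3 (s : scoring_vectors) (hs : positional_scoring_rule s) :
  polytime_decidable enc_instance
    (fun I : nw_instance =>
       necessary_winner (scoring_rule s) (partial_votes I) (candidate I)).
Proof.
have [srt [M [p haltM]]] := hs.
(* The machine for the vectors is specified for lengths [k.+1] only; the candidate itself witnesses
   that there is an alternative. *)
pose m1 (I : nw_instance) := #|alternatives I|.-1.
have cardE (I : nw_instance) : #|alternatives I| = (m1 I).+1.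
  by rewrite prednK //; apply/card_gt0P; exists (candidate I).
exists (fun I => decide_necessary_winner (enc_scores (s (m1 I).+1), enc_votes_instance I)).
  by move=> I; rewrite -cardE; apply: decide_necessary_winnerP.
apply: (@polytime_computable_oracle _ _ _ enc_instance (fun k => enc_scores (s k.+1))
  _ m1 enc_votes_instance) => [||I].
(* Elements of [word] are encoded as they are, so the output of the given machine already is the
   encoding of [enc_scores]. *)
- exists M, p => k; have := haltM k.
  by rewrite [enc _](_ : _ = enc_words (map bits_of_nat (s k.+1))) // /enc /= -map_comp.
- exact: ptime_decide_necessary_winner.
- rewrite /enc_instance cardE /enc_words /=; congr [:: true, true & _ ++ (_ ++ flatten _)].
  by rewrite -!map_comp.
Qed.
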